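(* Let $\varphi$ be a continuous real valued function on the unit circle, and let $u$ be the solution of the Dirichlet problem on the unit disc with boundary data $\varphi$, i.e. $u$ is the real valued continuous function on the closed unit disc that is harmonic-ave on the open unit disc $D_1(0)$ and equals $\varphi$ on the unit circle. Then for all $z\in D_1(0)$, $$u(z)=\frac{1}{2\pi}\int_0^{2\pi}K(z,e^{i\theta})\,\varphi(e^{i\theta})\,d\theta,\qquad K(z,w)=1+\frac{z\bar w}{1-z\bar w}+\frac{\bar z w}{1-\bar z w}.$$ Moreover, for all $z\in D_1(0)$, $u(z)=a_0+h(z)+\overline{h(z)}$, where $a_0=\frac{1}{2\pi}\int_0^{2\pi}\varphi(e^{i\theta})\,d\theta$ and $$h(z)=\frac{1}{2\pi}\int_0^{2\pi}\frac{ze^{-i\theta}}{1-ze^{-i\theta}}\,\varphi(e^{i\theta})\,d\theta$$ is an infinitely complex differentiable function on $D_1(0)$ with $h(0)=0$. Consequently $u$ is $C^\infty$-smooth on $D_1(0)$, satisfies the Laplace equation there, and is the real part of the infinitely complex differentiable function $H=a_0+2h$ on $D_1(0)$.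
   Context: For $a\in\mathbb{C}$ and $r>0$, $D_r(a)$ denotes the open disc of radius $r$ about $a$. A continuous complex valued function $u$ on an open set $\Omega\subset\mathbb{C}$ is called harmonic-ave on $\Omega$ if $u(a)=\frac{1}{2\pi}\int_0^{2\pi}u(a+re^{i\theta})\,d\theta$ whenever the closure of $D_r(a)$ is contained in $\Omega$. For every continuous real valued $\varphi$ on the unit circle, there is exactly one real valued function that is continuous on the closed unit disc, harmonic-ave on $D_1(0)$, and equal to $\varphi$ on the unit circle. *)

(* Defs.v *)
From Stdlib Require Export Reals.
From Coquelicot Require Export Coquelicot.

Open Scope C_scope.

Definition open_disc (a : C) (r : R) (z : C) : Prop := (Cmod (z - a) < r)%R.

Definition unit_disc : C -> Prop := open_disc 0 1.
Definition closed_unit_disc (z : C) : Prop := (Cmod z <= 1)%R.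
Definition unit_circle (z : C) : Prop := Cmod z = 1%R.

Definition closure {T : UniformSpace} (A : T -> Prop) (x : T) : Prop :=
  forall P : T -> Prop, locally x P -> exists y : T, P y /\ A y.

(* $e^{i\theta}$ *)
Definition expi (theta : R) : C := (cos theta, sin theta).

Definition angular_mean (F : R -> C) : C :=
  RtoC (/ (2 * PI))%R * RInt (V := C_R_CompleteNormedModule) F 0 (2 * PI).

Definition harmonic_ave (Omega : C -> Prop) (u : C -> C) : Prop :=
  open Omega /\
  continuous_on Omega u /\
  forall (a : C) (r : R), (0 < r)%R ->
    (forall z, closure (open_disc a r) z -> Omega z) ->
    u a = angular_mean (fun theta => u (a + r * expi theta)).

(* Functions on the closed disc or on the circle are represented by functions
   on C whose values elsewhere are irrelevant: continuity is relative to the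
   set, and every other requirement only concerns points of the set. *)
Definition dirichlet_solution (phi u : C -> R) : Prop :=
  continuous_on closed_unit_disc u /\
  harmonic_ave unit_disc (fun z => RtoC (u z)) /\
  (forall z, unit_circle z -> u z = phi z).

Definition poisson_kernel (z w : C) : C :=
  1 + z * Cconj w / (1 - z * Cconj w) + Cconj z * w / (1 - Cconj z * w).

Definition a0 (phi : C -> R) : R :=
  (/ (2 * PI) * RInt (fun theta => phi (expi theta)) 0 (2 * PI))%R.

Definition h_of (phi : C -> R) (z : C) : C :=
  angular_mean (fun theta =>
    z * expi (- theta) / (1 - z * expi (- theta)) * phi (expi theta)).

Definition H_of (phi : C -> R) (z : C) : C := a0 phi + 2 * h_of phi z.

(* For D open.  [C_derive] is total, but it is the complex derivative wherever
   the function is complex differentiable; so, by induction on n, the n-th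
   iterate below is the n-th derivative on D. *)
Definition infinitely_C_differentiable_on (D : C -> Prop) (f : C -> C) : Prop :=
  forall (n : nat) (z : C), D z ->
    ex_derive (K := C_AbsRing) (V := C_NormedModule) (Nat.iter n C_derive f) z.

(* Real partial derivatives, z = x + iy. *)
Definition ex_Dx (f : C -> R) (z : C) : Prop :=
  ex_derive (fun t : R => f (t, Im z)) (Re z).
Definition ex_Dy (f : C -> R) (z : C) : Prop :=
  ex_derive (fun t : R => f (Re z, t)) (Im z).
Definition Dx (f : C -> R) (z : C) : R :=
  Derive (fun t : R => f (t, Im z)) (Re z).
Definition Dy (f : C -> R) (z : C) : R :=
  Derive (fun t : R => f (Re z, t)) (Im z).

(* For D open: every iterated partial derivative of order at most k, in any
   order of differentiation, exists and is continuous on D. *)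
Fixpoint Ck_on (k : nat) (D : C -> Prop) (f : C -> R) : Prop :=
  continuous_on D f /\
  match k with
  | O => True
  | S k' =>
      (forall z, D z -> ex_Dx f z /\ ex_Dy f z) /\
      Ck_on k' D (Dx f) /\ Ck_on k' D (Dy f)
  end.

Definition Cinfty_on (D : C -> Prop) (f : C -> R) : Prop :=
  forall k : nat, Ck_on k D f.

Definition laplacian (f : C -> R) (z : C) : R :=
  (Dx (Dx f) z + Dy (Dy f) z)%R.

(* Main.v *)
Require Import Defs.
From Stdlib Require Import Lra Lia Psatz ClassicalEpsilon Factorial.

(** The Poisson integral [P] of [phi] is [a0 + 2 Re h] with [h] holomorphic, so
    everything follows from [u = P].  Since [K >= 0] has mean [1] and
    concentrates at the boundary, [P(r w)] tends to [phi(w)] uniformly in [w] on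
    the circle as [r -> 1].  Cutting off the geometric series of the kernel
    approximates [z |-> P(r z)] uniformly on the closed disc by harmonic
    polynomials, for which the mean value property is immediate; the maximum
    principle for the mean value property then bounds [u(z) - P(r z)] by its size
    on the circle, and [r -> 1] gives [u = P].  The derivatives of [h] come from
    an expansion of [1/(1 - z c)^n] in [z] with a quadratic error that is uniform
    in [c] on the circle. *)

(** * Continuity and circle means of complex-valued functions *)

(** For merely continuous data the series of the kernel need not converge uniformly up to the
    circle. At a fixed radius [r < 1] its tail is at most [r^(n+1) / (1 - r)] times a bound of
    [phi], so the limit in [n] is taken at fixed [r], and only afterwards [r -> 1]. Convergence at
    the boundary does not split the circle into a near and a far arc. Uniform continuity is recast
    as [|phi(e^(it)) - phi(w)| <= e + c |e^(it) - w|^2]; the square cancels the denominator of the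
    kernel, and one integration yields [e + 4 c (1 - r^2)]. Differentiation under the integral sign
    is replaced by an explicit sequence [G_n] of Cauchy-type integrals, each the derivative of the
    one before. Since [x / (1 - x) = 1 / (1 - x) - 1], the function [h] is [G_0] up to a constant,
    and every iterated partial derivative of [u] is the real part of a constant times some [G_n]. *)

Lemma continuous_C {T : UniformSpace} (f : T -> C) (x : T) :
  continuous (fun y => Re (f y)) x -> continuous (fun y => Im (f y)) x ->
  continuous f x.
Proof.
intros H1 H2 P [e He]; unfold filtermap.
apply (filter_imp (fun y => ball (Re (f x)) e (Re (f y)) /\ ball (Im (f x)) e (Im (f y)))).
- intros y Hy; apply He; exact Hy.
- apply filter_and; [apply H1 | apply H2]; apply locally_ball.
Qed.

Lemma continuous_Re {T : UniformSpace} (f : T -> C) (x : T) :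
  continuous f x -> continuous (fun y => Re (f y)) x.
Proof. intros H; apply (continuous_comp f Re); [exact H | apply continuous_fst]. Qed.

Lemma continuous_Im {T : UniformSpace} (f : T -> C) (x : T) :
  continuous f x -> continuous (fun y => Im (f y)) x.
Proof. intros H; apply (continuous_comp f Im); [exact H | apply continuous_snd]. Qed.

Lemma continuous_RtoC {T : UniformSpace} (f : T -> R) (x : T) :
  continuous f x -> continuous (fun y => RtoC (f y)) x.
Proof. intros H; apply continuous_C; [exact H | apply continuous_const]. Qed.

Lemma continuous_Cplus {T : UniformSpace} (f g : T -> C) (x : T) :
  continuous f x -> continuous g x -> continuous (fun y => f y + g y) x.
Proof.
intros Hf Hg; apply continuous_C; simpl;
  apply (continuous_plus (V := R_NormedModule));
  auto using continuous_Re, continuous_Im.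
Qed.

Lemma continuous_Copp {T : UniformSpace} (f : T -> C) (x : T) :
  continuous f x -> continuous (fun y => - f y) x.
Proof.
intros Hf; apply continuous_C; simpl;
  apply (continuous_opp (V := R_NormedModule));
  auto using continuous_Re, continuous_Im.
Qed.

Lemma continuous_Cminus {T : UniformSpace} (f g : T -> C) (x : T) :
  continuous f x -> continuous g x -> continuous (fun y => f y - g y) x.
Proof. intros Hf Hg; apply continuous_Cplus; [|apply continuous_Copp]; assumption. Qed.

Lemma continuous_Cconj {T : UniformSpace} (f : T -> C) (x : T) :
  continuous f x -> continuous (fun y => Cconj (f y)) x.
Proof.
intros Hf; apply continuous_C; simpl.
- apply continuous_Re, Hf.
- apply (continuous_opp (V := R_NormedModule)), continuous_Im, Hf.
Qed.

Lemma continuous_Cmult {T : UniformSpace} (f g : T -> C) (x : T) :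
  continuous f x -> continuous g x -> continuous (fun y => f y * g y) x.
Proof.
intros Hf Hg.
pose proof (continuous_Re _ _ Hf); pose proof (continuous_Im _ _ Hf).
pose proof (continuous_Re _ _ Hg); pose proof (continuous_Im _ _ Hg).
apply continuous_C; simpl.
- apply (continuous_minus (V := R_NormedModule)); apply (continuous_mult (K := R_AbsRing)); assumption.
- apply (continuous_plus (V := R_NormedModule)); apply (continuous_mult (K := R_AbsRing)); assumption.
Qed.

Lemma Cmod_sqr (z : C) : (Cmod z * Cmod z = Re z * Re z + Im z * Im z)%R.
Proof. generalize (Cmod2_alt z); simpl; lra. Qed.

Lemma continuous_Cmod {T : UniformSpace} (f : T -> C) (x : T) :
  continuous f x -> continuous (fun y => Cmod (f y)) x.
Proof.
intros Hf.
pose proof (continuous_Re _ _ Hf); pose proof (continuous_Im _ _ Hf).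
apply (continuous_ext (fun y => sqrt (Re (f y) * Re (f y) + Im (f y) * Im (f y)))).
{ intros y; rewrite <- Cmod_sqr; apply sqrt_square, Cmod_ge_0. }
apply continuous_comp with (g := sqrt); [|apply continuous_sqrt].
apply (continuous_plus (V := R_NormedModule)); apply (continuous_mult (K := R_AbsRing)); assumption.
Qed.

Lemma continuous_Cinv {T : UniformSpace} (f : T -> C) (x : T) :
  f x <> 0 -> continuous f x -> continuous (fun y => / f y) x.
Proof.
intros H0 Hf.
apply (continuous_ext (fun y => RtoC (/ (Cmod (f y) * Cmod (f y)))%R * Cconj (f y))).
{ intros y; rewrite Cmod_sqr; unfold Cinv, Cmult, Cconj, RtoC, Re, Im; simpl.
  f_equal; unfold Rdiv; rewrite !Rmult_1_r; ring. }
apply continuous_Cmult; [|apply continuous_Cconj, Hf].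
apply continuous_RtoC, (continuous_comp _ Rinv).
- apply (continuous_mult (K := R_AbsRing)); apply continuous_Cmod, Hf.
- apply continuous_Rinv. apply Cmod_gt_0 in H0. nra.
Qed.

Lemma continuous_Cpow {T : UniformSpace} (f : T -> C) (x : T) (n : nat) :
  continuous f x -> continuous (fun y => f y ^ n) x.
Proof.
intros Hf; induction n as [|n IH].
- apply continuous_const.
- apply (continuous_Cmult f (fun y => f y ^ n)); assumption.
Qed.

(** Relative continuity becomes ordinary continuity because [g] never leaves [A]. It serves for
    [expi] with values in the circle and for the retraction onto the closed disc. *)
Lemma continuous_on_comp_continuous {T U V : UniformSpace} (A : U -> Prop)
    (f : U -> V) (g : T -> U) (x : T) :
  continuous_on A f -> (forall y, A (g y)) -> continuous g x ->
  continuous (fun y => f (g y)) x.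
Proof.
intros Hf HA Hg P HP.
specialize (Hg _ (Hf (g x) (HA x) P HP)).
unfold filtermap in *; revert Hg; apply filter_imp; intros y Hy; apply Hy, HA.
Qed.

Lemma continuous_expi (t : R) : continuous expi t.
Proof. apply continuous_C; [apply continuous_cos | apply continuous_sin]. Qed.

Lemma Cmod_expi (t : R) : Cmod (expi t) = 1%R.
Proof.
unfold Cmod, expi; simpl.
replace (_ + _)%R with 1%R; [apply sqrt_1|].
generalize (sin2_cos2 t); unfold Rsqr; lra.
Qed.

Lemma unit_circle_expi (t : R) : unit_circle (expi t).
Proof. exact (Cmod_expi t). Qed.

Lemma Cconj_expi (t : R) : Cconj (expi t) = expi (- t).
Proof. unfold expi, Cconj; simpl. rewrite cos_neg, sin_neg; reflexivity. Qed.

Lemma Cpow_expi (n : nat) (t : R) : expi t ^ n = expi (INR n * t).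
Proof.
induction n as [|n IH].
- simpl; unfold expi; rewrite Rmult_0_l, cos_0, sin_0; reflexivity.
- rewrite Cpow_S, IH, S_INR; unfold expi, Cmult; simpl.
  replace ((INR n + 1) * t)%R with (INR n * t + t)%R by ring.
  rewrite cos_plus, sin_plus; f_equal; ring.
Qed.

Lemma continuous_expi_opp (t : R) : continuous (fun s => expi (- s)) t.
Proof.
apply (continuous_ext (fun s => Cconj (expi s))); [exact Cconj_expi|].
apply continuous_Cconj, continuous_expi.
Qed.

(** Relational form of [angular_mean]: integrability and value travel together, so algebra with
    means creates no side conditions. *)
Definition is_mean (f : R -> C) (l : C) : Prop :=
  is_RInt (V := C_R_NormedModule) f 0 (2 * PI) (RtoC (2 * PI) * l).

Lemma two_PI_pos : (0 < 2 * PI)%R.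
Proof. generalize PI_RGT_0; lra. Qed.

Lemma is_mean_unique (f : R -> C) (l : C) : is_mean f l -> angular_mean f = l.
Proof.
intros H; unfold angular_mean.
rewrite (is_RInt_unique (V := C_R_CompleteNormedModule) _ _ _ _ H).
rewrite Cmult_assoc, <- RtoC_mult, Rinv_l, Cmult_1_l; [reflexivity|].
generalize two_PI_pos; lra.
Qed.

Lemma is_mean_continuous (f : R -> C) :
  (forall t, continuous f t) -> is_mean f (angular_mean f).
Proof.
intros H; unfold is_mean, angular_mean.
rewrite Cmult_assoc, <- RtoC_mult, Rinv_r, Cmult_1_l by (generalize two_PI_pos; lra).
apply (RInt_correct (V := C_R_CompleteNormedModule)).
apply (ex_RInt_continuous (V := C_R_CompleteNormedModule)).
intros z _; apply H.
Qed.

Lemma is_mean_ext (f g : R -> C) (l : C) :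
  (forall t, f t = g t) -> is_mean f l -> is_mean g l.
Proof. intros H; apply is_RInt_ext; intros x _; apply H. Qed.

Lemma is_mean_plus (f g : R -> C) (l m : C) :
  is_mean f l -> is_mean g m -> is_mean (fun t => f t + g t) (l + m).
Proof.
intros Hf Hg; unfold is_mean; rewrite Cmult_plus_distr_l.
exact (is_RInt_plus (V := C_R_NormedModule) _ _ _ _ _ _ Hf Hg).
Qed.

(** The integral lives in a module over the reals, so a complex factor is treated on real and
    imaginary parts, each a real linear combination of two real integrals. *)
Lemma is_mean_mult_l (c : C) (f : R -> C) (l : C) :
  is_mean f l -> is_mean (fun t => c * f t) (c * l).
Proof.
intros Hf.
pose proof (is_RInt_fct_extend_fst (U := R_NormedModule) (V := R_NormedModule) _ _ _ _ Hf) as H1.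
pose proof (is_RInt_fct_extend_snd (U := R_NormedModule) (V := R_NormedModule) _ _ _ _ Hf) as H2.
apply (is_RInt_fct_extend_pair (U := R_NormedModule) (V := R_NormedModule)); simpl.
- pose proof (is_RInt_minus _ _ _ _ _ _ (is_RInt_scal _ _ _ (fst c) _ H1)
    (is_RInt_scal _ _ _ (snd c) _ H2)) as H.
  replace (_ - _)%R with (minus (scal (fst c) (fst (RtoC (2 * PI) * l)))
    (scal (snd c) (snd (RtoC (2 * PI) * l)))); [exact H|].
  unfold minus, plus, opp, scal; simpl; unfold mult; simpl; ring.
- pose proof (is_RInt_plus _ _ _ _ _ _ (is_RInt_scal _ _ _ (fst c) _ H2)
    (is_RInt_scal _ _ _ (snd c) _ H1)) as H.
  replace (_ + _)%R with (plus (scal (fst c) (snd (RtoC (2 * PI) * l)))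
    (scal (snd c) (fst (RtoC (2 * PI) * l)))); [exact H|].
  unfold plus, opp, scal; simpl; unfold mult; simpl; ring.
Qed.

Lemma is_mean_minus (f g : R -> C) (l m : C) :
  is_mean f l -> is_mean g m -> is_mean (fun t => f t - g t) (l - m).
Proof.
intros Hf Hg.
apply (is_mean_ext (fun t => f t + (-1) * g t)); [intros t; ring|].
replace (l - m) with (l + (-1) * m) by ring.
apply is_mean_plus; [|apply is_mean_mult_l]; assumption.
Qed.

Lemma is_mean_conj (f : R -> C) (l : C) :
  is_mean f l -> is_mean (fun t => Cconj (f t)) (Cconj l).
Proof.
intros Hf.
pose proof (is_RInt_fct_extend_fst (U := R_NormedModule) (V := R_NormedModule) _ _ _ _ Hf) as H1.
pose proof (is_RInt_fct_extend_snd (U := R_NormedModule) (V := R_NormedModule) _ _ _ _ Hf) as H2.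
apply (is_RInt_fct_extend_pair (U := R_NormedModule) (V := R_NormedModule)); simpl.
- replace (_ - _)%R with (fst (RtoC (2 * PI) * l)); [exact H1|simpl; ring].
- replace (_ + _)%R with (opp (snd (RtoC (2 * PI) * l)));
   [apply (is_RInt_opp _ _ _ _ H2)|unfold opp; simpl; ring].
Qed.

Lemma is_mean_const (c : C) : is_mean (fun _ => c) c.
Proof.
pose proof (is_RInt_const (V := C_R_NormedModule) 0 (2 * PI) c) as H.
unfold is_mean; replace (RtoC (2 * PI) * c) with (scal (V := C_R_NormedModule) (2 * PI - 0)%R c);
  [exact H|].
rewrite Rminus_0_r; apply scal_R_Cmult.
Qed.

Lemma is_mean_Re (f : R -> C) (l : C) :
  is_mean f l -> is_mean (fun t => RtoC (Re (f t))) (RtoC (Re l)).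
Proof.
intros H.
apply (is_mean_ext (fun t => /2 * (f t + Cconj (f t)))).
{ intros t; rewrite re_alt; field. }
rewrite re_alt; replace ((l + Cconj l) / 2) with (/2 * (l + Cconj l)) by field.
apply is_mean_mult_l, is_mean_plus; [|apply is_mean_conj]; exact H.
Qed.

Lemma norm_C_R (z : C) : norm (V := C_R_NormedModule) z = Cmod z.
Proof.
unfold norm; simpl; unfold prod_norm, norm; simpl; unfold Cmod, abs; simpl.
rewrite !Rmult_1_r, <- !Rabs_mult, !Rabs_right; [reflexivity| |]; apply Rle_ge, Rle_0_sqr.
Qed.

Lemma is_mean_Cmod_le (f : R -> C) (g : R -> R) (l : C) (m : R) :
  (forall t, Cmod (f t) <= g t)%R ->
  is_mean f l -> is_mean (fun t => RtoC (g t)) (RtoC m) -> (Cmod l <= m)%R.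
Proof.
intros Hle Hf Hg.
pose proof (is_RInt_fct_extend_fst (U := R_NormedModule) (V := R_NormedModule) _ _ _ _ Hg) as H1.
simpl in H1.
pose proof (norm_RInt_le (V := C_R_NormedModule) f g 0 (2 * PI) _ _ (Rlt_le _ _ two_PI_pos)
  (fun t _ => eq_ind_r (fun x => (x <= g t)%R) (Hle t) (norm_C_R (f t))) Hf H1) as H.
rewrite norm_C_R, Cmod_mult, Cmod_R, Rabs_pos_eq in H by (generalize two_PI_pos; lra).
apply (Rmult_le_reg_l (2 * PI)); [exact two_PI_pos|].
lra.
Qed.

Lemma is_mean_Cmod_le_const (f : R -> C) (l : C) (m : R) :
  (forall t, Cmod (f t) <= m)%R -> is_mean f l -> (Cmod l <= m)%R.
Proof. intros H Hf; exact (is_mean_Cmod_le f (fun _ => m) l m H Hf (is_mean_const _)). Qed.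

Lemma is_mean_le (f g : R -> R) (l m : R) :
  (forall t, f t <= g t)%R ->
  is_mean (fun t => RtoC (f t)) (RtoC l) -> is_mean (fun t => RtoC (g t)) (RtoC m) ->
  (l <= m)%R.
Proof.
intros Hle Hf Hg.
(* Monotonicity is read off the norm estimate for the zero function, dominated by [g - f >= 0]. *)
enough (Cmod 0 <= m - l)%R by (generalize (Cmod_ge_0 0); lra).
apply (is_mean_Cmod_le (fun _ => 0) (fun t => g t - f t)%R).
- intros t; rewrite Cmod_0; generalize (Hle t); lra.
- apply is_mean_const.
- rewrite RtoC_minus.
  apply (is_mean_ext (fun t => RtoC (g t) - RtoC (f t))); [intros t; now rewrite RtoC_minus|].
  now apply is_mean_minus.
Qed.

(** Both components of [e^(i(n+1)t)] have an antiderivative of period [2 PI]; the exponent [S n]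
    makes the division by it legitimate. *)
Lemma is_mean_expi_pow (n : nat) : is_mean (fun t => expi t ^ S n) 0.
Proof.
assert (Hn : INR (S n) <> 0%R) by (apply not_0_INR; lia).
assert (E : forall F f, (forall t, is_derive F t (f t)) -> (forall t, continuous f t) ->
   F (2 * PI)%R = F 0%R -> is_RInt f 0 (2 * PI) 0%R).
{ intros F f HF Hf HE.
  replace 0%R with (minus (F (2 * PI)%R) (F 0%R)) at 2.
  - apply (is_RInt_derive (V := R_CompleteNormedModule) F f); intros; [apply HF|apply Hf].
  - rewrite HE; unfold minus, plus, opp; simpl; ring. }
assert (P1 : (INR (S n) * (2 * PI) = 0 + 2 * INR (S n) * PI)%R) by ring.
apply (is_mean_ext (fun t => expi (INR (S n) * t))); [intros t; now rewrite Cpow_expi|].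
unfold is_mean; rewrite Cmult_0_r.
apply (is_RInt_fct_extend_pair (U := R_NormedModule) (V := R_NormedModule)); simpl fst; simpl snd.
- apply (E (fun t => / INR (S n) * sin (INR (S n) * t))%R).
  + intros t; auto_derive; [trivial|]; field; exact Hn.
  + intros t; apply (continuous_comp (fun t => INR (S n) * t)%R cos); [|apply continuous_cos].
    apply (continuous_mult (K := R_AbsRing)); [apply continuous_const|apply continuous_id].
  + rewrite P1, sin_period, Rmult_0_r; reflexivity.
- apply (E (fun t => - / INR (S n) * cos (INR (S n) * t))%R).
  + intros t; auto_derive; [trivial|]; field; exact Hn.
  + intros t; apply (continuous_comp (fun t => INR (S n) * t)%R sin); [|apply continuous_sin].
    apply (continuous_mult (K := R_AbsRing)); [apply continuous_const|apply continuous_id].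
  + rewrite P1, cos_period, Rmult_0_r; reflexivity.
Qed.

(** * Maximum principle *)

(** Maximise first in [y], with a chosen maximiser [g x], then in [x]. The choice [g] may jump, but
    [F (x, g x)] is continuous in [x] by uniform continuity of [F]. *)
Lemma continuous_attains_max_square (F : C -> R) :
  (forall z, continuous F z) ->
  exists p : C, forall x y : R, (-1 <= x <= 1)%R -> (-1 <= y <= 1)%R -> (F (x, y) <= F p)%R.
Proof.
intros HF.
assert (H2 : forall x y, continuity_2d_pt (fun x y => F (x, y)) x y).
{ intros x y; apply continuity_2d_pt_filterlim.
  apply (filterlim_ext F); [intros [a b]; reflexivity|apply (HF (x, y))]. }
assert (Hm : forall x, exists m, (forall y, (-1 <= y <= 1)%R -> (F (x, y) <= F (x, m))%R)
  /\ (-1 <= m <= 1)%R).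
{ intros x.
  destruct (continuity_ab_maj (fun y => F (x, y)) (-1) 1) as [m Hm]; [lra| |exists m; exact Hm].
  intros c _; apply continuity_pt_locally; intros e.
  exact (locally_2d_1d_const_x _ _ _ (H2 x c e)). }
assert (Hg : exists g : R -> R, forall x y, (-1 <= y <= 1)%R -> (F (x, y) <= F (x, g x))%R
   /\ (-1 <= g x <= 1)%R).
{ exists (fun x => proj1_sig (constructive_indefinite_description _ (Hm x))).
  intros x y Hxy; destruct (constructive_indefinite_description _ (Hm x)) as [m [Hm1 Hm2]]; simpl.
  split; auto. }
destruct Hg as [g Hg].
destruct (continuity_ab_maj (fun x => F (x, g x)) (-1) 1) as [x0 [Hx0 _]]; [lra| |].
- intros c Hc; apply continuity_pt_locally; intros e.
  (* Points near an abscissa [c] in [[-1, 1]] may lie outside that interval; with the radius capped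
     at [1] they stay in [[-2, 2]]. *)
  destruct (uniform_continuity_2d (fun x y => F (x, y)) (-2) 2 (-1) 1 (fun x y _ _ => H2 x y) e)
    as [d Hd].
  assert (Hd1 : (0 < Rmin d 1)%R) by (apply Rmin_pos; [apply cond_pos|lra]).
  exists (mkposreal _ Hd1); intros x Hx; change R in x.
  assert (Hx1 : (Rabs (x - c) < Rmin d 1)%R) by exact Hx.
  assert (Hx2 : (Rabs (x - c) < d)%R) by (eapply Rlt_le_trans; [exact Hx1|apply Rmin_l]).
  assert (Hx3 : (Rabs (x - c) < 1)%R) by (eapply Rlt_le_trans; [exact Hx1|apply Rmin_r]).
  apply Rabs_def2 in Hx3.
  assert (U : forall y, (-1 <= y <= 1)%R -> (Rabs (F (x, y) - F (c, y)) < e)%R).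
  { intros y Hy1; apply Hd; [lra..|exact Hx2|].
    unfold Rminus; rewrite Rplus_opp_r, Rabs_R0; apply cond_pos. }
  destruct (Hg x 0%R) as [_ G1]; [lra|]; destruct (Hg c 0%R) as [_ G2]; [lra|].
  (* Each maximiser is tested at the other abscissa: [F (x, g x) >= F (x, g c) > F (c, g c) - e],
     and symmetrically. *)
  destruct (Hg x (g c) G2) as [G3 _]; destruct (Hg c (g x) G1) as [G4 _].
  generalize (U _ G1) (U _ G2); intros U1 U2.
  apply Rabs_def2 in U1; apply Rabs_def2 in U2; apply Rabs_def1; lra.
- exists (x0, g x0); intros x y Hx Hy1.
  apply Rle_trans with (F (x, g x)); [apply Hg; exact Hy1|apply Hx0; exact Hx].
Qed.

(** A continuous retraction of the plane onto the closed disc. Composing with it extends a function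
    continuous on the disc to the whole plane, where the results about squares apply. *)
Definition radial_retraction (z : C) : C := RtoC (/ Rmax 1 (Cmod z)) * z.

Lemma radial_retraction_closed_unit_disc (z : C) : closed_unit_disc (radial_retraction z).
Proof.
unfold closed_unit_disc, radial_retraction.
assert (H1 := Rmax_l 1 (Cmod z)); assert (H2 := Rmax_r 1 (Cmod z)).
assert (H3 := Rinv_0_lt_compat (Rmax 1 (Cmod z)) ltac:(lra)).
rewrite Cmod_mult, Cmod_R, Rabs_pos_eq by lra.
apply Rmult_le_reg_l with (Rmax 1 (Cmod z)); [lra|].
rewrite <- Rmult_assoc, Rinv_r by lra; lra.
Qed.

Lemma radial_retraction_id (z : C) : closed_unit_disc z -> radial_retraction z = z.
Proof.
intros H; unfold radial_retraction; rewrite Rmax_left by exact H.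
rewrite Rinv_1; apply Cmult_1_l.
Qed.

Lemma continuous_radial_retraction (z : C) : continuous radial_retraction z.
Proof.
apply continuous_Cmult; [|apply continuous_id].
apply continuous_RtoC, (continuous_comp (fun z => Rmax 1 (Cmod z)) Rinv).
- apply (continuous_ext (fun z => (1 + Cmod z + Rabs (1 - Cmod z)) / 2)%R).
  { intros y; unfold Rmax, Rabs; destruct (Rle_dec _ _); destruct (Rcase_abs _); lra. }
  assert (Hc : continuous Cmod z) by (apply continuous_Cmod, continuous_id).
  apply (continuous_mult (K := R_AbsRing)); [|apply continuous_const].
  apply (continuous_plus (V := R_NormedModule)).
  + apply (continuous_plus (V := R_NormedModule)); [apply continuous_const|exact Hc].
  + apply (continuous_comp (fun z => 1 - Cmod z)%R Rabs); [|apply continuous_Rabs].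
    apply (continuous_minus (V := R_NormedModule)); [apply continuous_const|exact Hc].
- apply continuous_Rinv; generalize (Rmax_l 1 (Cmod z)); lra.
Qed.

Lemma continuous_comp_radial_retraction (u : C -> R) (z : C) :
  continuous_on closed_unit_disc u -> continuous (fun z => u (radial_retraction z)) z.
Proof.
intros Hu; apply (continuous_on_comp_continuous closed_unit_disc u radial_retraction).
- exact Hu.
- exact radial_retraction_closed_unit_disc.
- apply continuous_radial_retraction.
Qed.

Lemma Re_Im_closed_unit_disc (z : C) : closed_unit_disc z ->
  (-1 <= Re z <= 1)%R /\ (-1 <= Im z <= 1)%R.
Proof.
intros H; unfold closed_unit_disc in H.
generalize (Cmod_sqr z) (Cmod_ge_0 z); intros; split; nra.
Qed.

Lemma continuous_on_closed_disc_attains_max (v : C -> R) :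
  continuous_on closed_unit_disc v ->
  exists p, closed_unit_disc p /\ forall z, closed_unit_disc z -> (v z <= v p)%R.
Proof.
intros Hv.
destruct (continuous_attains_max_square (fun z => v (radial_retraction z))) as [p Hp].
{ intros z; apply continuous_comp_radial_retraction, Hv. }
exists (radial_retraction p); split; [apply radial_retraction_closed_unit_disc|].
intros z Hz; rewrite <- (radial_retraction_id z Hz) at 1.
destruct (Re_Im_closed_unit_disc z Hz) as [H1 H2].
specialize (Hp _ _ H1 H2); destruct z; exact Hp.
Qed.

Lemma continuous_on_closed_disc_bounded (v : C -> R) :
  continuous_on closed_unit_disc v ->
  exists M, forall z, closed_unit_disc z -> (Rabs (v z) <= M)%R.
Proof.
intros Hv.
destruct (continuous_on_closed_disc_attains_max (fun z => Rabs (v z))) as [p [_ Hp]].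
- intros z Hz; apply (filterlim_comp _ _ _ v Rabs _ (locally (v z))); [apply Hv, Hz|].
  apply continuous_Rabs.
- exists (Rabs (v p)); exact Hp.
Qed.

Lemma continuous_on_closed_disc_unif (v : C -> R) (e : posreal) :
  continuous_on closed_unit_disc v ->
  exists d : posreal, forall z w, closed_unit_disc z -> closed_unit_disc w ->
    (Cmod (w - z) < d -> Rabs (v w - v z) < e)%R.
Proof.
intros Hv.
destruct (uniform_continuity_2d (fun x y => v (radial_retraction (x, y))) (-1) 1 (-1) 1)
  with (eps := e) as [d Hd].
- intros x y _ _; apply continuity_2d_pt_filterlim.
  apply (filterlim_ext (fun z => v (radial_retraction z))); [intros [a b]; reflexivity|].
  apply (continuous_comp_radial_retraction v (x, y)), Hv.
- exists d; intros z w Hz Hw H.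
  destruct (Re_Im_closed_unit_disc z Hz) as [H1 H2].
  destruct (Re_Im_closed_unit_disc w Hw) as [H3 H4].
  assert (H5 := Rmax_Cmod (w - z)).
  assert (H6 := Rmax_l (Rabs (fst (w - z))) (Rabs (snd (w - z)))).
  assert (H7 := Rmax_r (Rabs (fst (w - z))) (Rabs (snd (w - z)))).
  specialize (Hd _ _ _ _ H1 H2 H3 H4).
  rewrite <- (radial_retraction_id z Hz), <- (radial_retraction_id w Hw) at 1.
  destruct z as [z1 z2], w as [w1 w2]; apply Hd; simpl in *; unfold Rminus; lra.
Qed.

(** The condition [Cmod a + r < 1] says that the closed disc lies in the open unit disc. Stated with
    [is_mean], the property includes integrability and so passes to linear combinations. *)
Definition mean_value_on_unit_disc (v : C -> R) : Prop :=
  forall (a : C) (r : R), (0 < r)%R -> (Cmod a + r < 1)%R ->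
    is_mean (fun t => RtoC (v (a + RtoC r * expi t))) (RtoC (v a)).

Lemma continuous_on_Rplus (A : C -> Prop) (f g : C -> R) :
  continuous_on A f -> continuous_on A g -> continuous_on A (fun z => f z + g z)%R.
Proof.
intros Hf Hg z Hz.
eapply filterlim_comp_2; [apply Hf, Hz|apply Hg, Hz|].
exact (filterlim_plus (V := R_NormedModule) (f z) (g z)).
Qed.

Lemma continuous_Rmult_Cmod_sqr (e : R) (z : C) :
  continuous (fun w : C => e * Cmod w ^ 2)%R z.
Proof.
assert (Hw2 : continuous Cmod z) by apply continuous_Cmod, continuous_id.
apply (continuous_mult (K := R_AbsRing)); [apply continuous_const|].
apply (continuous_mult (K := R_AbsRing)); [exact Hw2|].
apply (continuous_mult (K := R_AbsRing)); [exact Hw2|apply continuous_const].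
Qed.

(** The cross term [2 r Re (conj(a) e^(it))] averages to zero. The surplus [r^2] is what drives the
    maximum principle. *)
Lemma is_mean_Cmod_sqr_circle (a : C) (r : R) :
  is_mean (fun t => RtoC (Cmod (a + RtoC r * expi t) ^ 2)) (RtoC (Cmod a ^ 2 + r ^ 2)).
Proof.
apply (is_mean_ext (fun t => RtoC (Cmod a ^ 2 + r ^ 2) +
  RtoC (Re (2 * r * Cconj a * (expi t ^ 1))))).
- intros t; rewrite Cpow_1_r, <- RtoC_plus; apply f_equal.
  rewrite !Cmod2_alt; unfold expi; destruct a as [x y]; simpl.
  replace (r * (r * 1))%R with (r * r * (Rsqr (sin t) + Rsqr (cos t)))%R
    by (rewrite sin2_cos2; ring).
  unfold Rsqr; ring.
- pose proof (is_mean_plus _ _ _ _ (is_mean_const (RtoC (Cmod a ^ 2 + r ^ 2)))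
    (is_mean_Re _ _ (is_mean_mult_l (2 * r * Cconj a) _ _ (is_mean_expi_pow 0)))) as H.
  rewrite Cmult_0_r, re_RtoC, Cplus_0_r in H; exact H.
Qed.

(* At an interior maximum of [v + e |z|^2], the mean over a small circle would
   exceed the value at the centre by [e r^2]. *)
Lemma mean_value_max_principle (v : C -> R) (m : R) :
  continuous_on closed_unit_disc v -> mean_value_on_unit_disc v ->
  (forall z, unit_circle z -> (v z <= m)%R) ->
  forall z, closed_unit_disc z -> (v z <= m)%R.
Proof.
intros Hc Hmv Hb z Hz.
apply Rnot_lt_le; intros Hlt.
(* On the disc the perturbation is at most [e], half the supposed excess. A maximum on the circle
   would therefore give [v z <= m + e < v z]. *)
set (e := ((v z - m) / 2)%R).
assert (He : (0 < e)%R) by (unfold e; lra).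
destruct (continuous_on_closed_disc_attains_max (fun w => v w + e * Cmod w ^ 2)%R) as [p [Hp Hmax]].
{ apply continuous_on_Rplus; [exact Hc|].
  apply continuous_on_forall; intros w _; apply continuous_Rmult_Cmod_sqr. }
destruct (Rle_lt_or_eq_dec _ _ Hp) as [Hp1|Hp1].
- set (r := ((1 - Cmod p) / 2)%R).
  assert (Hr : (0 < r)%R) by (unfold r; lra).
  assert (Hpr : (Cmod p + r < 1)%R) by (unfold r; lra).
  assert (Hm : is_mean
    (fun t => RtoC (v (p + RtoC r * expi t) + e * Cmod (p + RtoC r * expi t) ^ 2))
    (RtoC (v p + e * (Cmod p ^ 2 + r ^ 2)))).
  { rewrite RtoC_plus, RtoC_mult.
    apply (is_mean_ext (fun t => RtoC (v (p + RtoC r * expi t)) +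
      RtoC e * RtoC (Cmod (p + RtoC r * expi t) ^ 2))).
    - intros t; rewrite RtoC_plus, RtoC_mult; reflexivity.
    - apply is_mean_plus; [apply Hmv; assumption|].
      apply is_mean_mult_l, is_mean_Cmod_sqr_circle. }
  pose proof (is_mean_le _ _ _ _ (fun t => Hmax (p + RtoC r * expi t) ltac:(
    unfold closed_unit_disc; apply Rle_trans with (1 := Cmod_triangle _ _);
    rewrite Cmod_mult, Cmod_expi, Cmod_R, Rabs_pos_eq; lra)) Hm (is_mean_const _)) as H.
  assert (0 < e * r ^ 2)%R by (apply Rmult_lt_0_compat; [|apply pow_lt]; assumption).
  cbv beta in H; lra.
- specialize (Hmax z Hz); rewrite Hp1 in Hmax.
  specialize (Hb p Hp1); unfold closed_unit_disc in Hz; generalize (Cmod_ge_0 z); intros.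
  assert (0 <= Cmod z ^ 2)%R by nra.
  assert (0 <= e * Cmod z ^ 2)%R by nra.
  unfold e in *; lra.
Qed.

(** * Poisson kernel and its truncations *)

Lemma unit_disc_Cmod (z : C) : unit_disc z <-> (Cmod z < 1)%R.
Proof.
unfold unit_disc, open_disc; replace (z - 0) with z by ring; reflexivity.
Qed.

Lemma Cmod_one_minus_ge (x : C) : (1 - Cmod x <= Cmod (1 - x))%R.
Proof.
generalize (Cmod_triangle (1 - x) x); replace (1 - x + x) with (RtoC 1) by ring.
rewrite Cmod_1; lra.
Qed.

Lemma one_minus_neq_0 (x : C) : (Cmod x < 1)%R -> 1 - x <> 0.
Proof. intros H; apply Cmod_gt_0; generalize (Cmod_one_minus_ge x); lra. Qed.

Lemma Cmod_mult_expi (z : C) (t : R) : Cmod (z * expi t) = Cmod z.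
Proof. rewrite Cmod_mult, Cmod_expi; ring. Qed.

(** Partial sum of the series of [x / (1 - x)], hence without constant term. *)
Fixpoint geom (n : nat) (x : C) : C :=
  match n with
  | O => 0
  | S m => geom m x + x ^ S m
  end.

Lemma geom_remainder (n : nat) (x : C) :
  1 - x <> 0 -> x / (1 - x) - geom n x = x ^ S n / (1 - x).
Proof.
intros H; induction n as [|n IH].
- simpl; field; exact H.
- change (geom (S n) x) with (geom n x + x ^ S n); replace (x / (1 - x) - (geom n x + x ^ S n))
    with (x / (1 - x) - geom n x - x ^ S n) by ring.
  rewrite IH; simpl; field; exact H.
Qed.

Lemma continuous_geom {T : UniformSpace} (n : nat) (f : T -> C) (x : T) :
  continuous f x -> continuous (fun y => geom n (f y)) x.
Proof.
intros Hf; induction n as [|n IH]; [apply continuous_const|].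
apply (continuous_Cplus (fun y => geom n (f y)) (fun y => f y ^ S n)); [exact IH|].
apply continuous_Cpow, Hf.
Qed.

Lemma is_mean_RtoC (f : R -> R) :
  (forall t, continuous f t) ->
  is_mean (fun t => RtoC (f t)) (RtoC (/ (2 * PI) * RInt f 0 (2 * PI))).
Proof.
intros Hf; unfold is_mean.
rewrite <- RtoC_mult, <- Rmult_assoc, Rinv_r, Rmult_1_l by (generalize two_PI_pos; lra).
apply (is_RInt_fct_extend_pair (U := R_NormedModule) (V := R_NormedModule)); simpl.
- apply (RInt_correct (V := R_CompleteNormedModule)).
  apply (ex_RInt_continuous (V := R_CompleteNormedModule)); intros z _; apply Hf.
- pose proof (is_RInt_const (V := R_NormedModule) 0 (2 * PI) 0%R) as H.
  rewrite (scal_zero_r (V := R_NormedModule)) in H; unfold zero in H; simpl in H.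
  rewrite ?Rmult_0_l, ?Rmult_0_r, ?Rplus_0_r; exact H.
Qed.

Definition continuous_boundary (phi : C -> R) : Prop :=
  forall t, continuous (fun s => phi (expi s)) t.

Lemma continuous_on_circle_boundary (phi : C -> R) :
  continuous_on unit_circle phi -> continuous_boundary phi.
Proof.
intros H t; apply (continuous_on_comp_continuous unit_circle phi expi).
- exact H.
- exact unit_circle_expi.
- apply continuous_expi.
Qed.

(** By [h_trunc_S] this is a polynomial in [z] of degree at most [n], with the Fourier coefficients
    of [phi] as coefficients. *)
Definition h_trunc (phi : C -> R) (n : nat) (z : C) : C :=
  angular_mean (fun t => geom n (z * expi (- t)) * phi (expi t)).

Definition fourier_coef (phi : C -> R) (n : nat) : C :=
  angular_mean (fun t => expi (- t) ^ n * phi (expi t)).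

Lemma continuous_mult_expi_opp (z : C) (t : R) : continuous (fun s => z * expi (- s)) t.
Proof. apply continuous_Cmult; [apply continuous_const|apply continuous_expi_opp]. Qed.

Lemma is_mean_h_trunc (phi : C -> R) (n : nat) (z : C) :
  continuous_boundary phi ->
  is_mean (fun t => geom n (z * expi (- t)) * phi (expi t)) (h_trunc phi n z).
Proof.
intros H; apply is_mean_continuous; intros t.
apply continuous_Cmult; [apply continuous_geom, continuous_mult_expi_opp|].
apply continuous_RtoC, H.
Qed.

Lemma h_trunc_0 (phi : C -> R) (z : C) : h_trunc phi 0 z = 0.
Proof.
apply is_mean_unique, (is_mean_ext (fun _ => 0)); [|apply is_mean_const].
intros t; simpl; ring.
Qed.

Lemma h_trunc_S (phi : C -> R) (n : nat) (z : C) :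
  continuous_boundary phi ->
  h_trunc phi (S n) z = h_trunc phi n z + z ^ S n * fourier_coef phi (S n).
Proof.
intros H; apply is_mean_unique.
apply (is_mean_ext (fun t => geom n (z * expi (- t)) * phi (expi t)
  + z ^ S n * (expi (- t) ^ S n * phi (expi t)))).
- intros t; change (geom (S n) (z * expi (- t)))
    with (geom n (z * expi (- t)) + (z * expi (- t)) ^ S n).
  rewrite Cpow_mult_l; ring.
- apply is_mean_plus; [apply is_mean_h_trunc, H|].
  apply is_mean_mult_l, is_mean_continuous; intros t.
  apply continuous_Cmult; [apply continuous_Cpow, continuous_expi_opp|].
  apply continuous_RtoC, H.
Qed.

Lemma continuous_h_trunc (phi : C -> R) (n : nat) (z : C) :
  continuous_boundary phi -> continuous (h_trunc phi n) z.
Proof.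
intros H; induction n as [|n IH].
- apply (continuous_ext (fun _ : C => RtoC 0)); [intros w; symmetry; apply h_trunc_0|apply continuous_const].
- apply (continuous_ext (fun w => h_trunc phi n w + w ^ S n * fourier_coef phi (S n))).
  + intros w; symmetry; apply h_trunc_S, H.
  + apply continuous_Cplus; [exact IH|].
    apply continuous_Cmult; [apply continuous_Cpow, continuous_id|apply continuous_const].
Qed.

(* The factor [expi t ^ k] makes the induction on [n] go through. *)
Lemma is_mean_pow_circle (n k : nat) (a c : C) :
  is_mean (fun t => (a + c * expi t) ^ n * expi t ^ k)
    (match k with O => a ^ n | S _ => 0 end).
Proof.
revert k; induction n as [|n IH]; intros k.
- apply (is_mean_ext (fun t => expi t ^ k)); [intros t; simpl; ring|].
  destruct k; [apply is_mean_const|apply is_mean_expi_pow].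
- apply (is_mean_ext (fun t => a * ((a + c * expi t) ^ n * expi t ^ k)
    + c * ((a + c * expi t) ^ n * expi t ^ S k))); [intros t; simpl; ring|].
  pose proof (is_mean_plus _ _ _ _ (is_mean_mult_l a _ _ (IH k))
    (is_mean_mult_l c _ _ (IH (S k)))) as H.
  replace (match k with O => a ^ S n | S _ => 0 end)
    with (a * (match k with O => a ^ n | S _ => 0 end) + c * 0); [exact H|].
  destruct k; simpl; ring.
Qed.

Lemma is_mean_h_trunc_circle (phi : C -> R) (n : nat) (a c : C) :
  continuous_boundary phi ->
  is_mean (fun t => h_trunc phi n (a + c * expi t)) (h_trunc phi n a).
Proof.
intros H; induction n as [|n IH].
- rewrite h_trunc_0; apply (is_mean_ext (fun _ => 0)); [|apply is_mean_const].
  intros t; symmetry; apply h_trunc_0.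
- rewrite h_trunc_S by exact H.
  apply (is_mean_ext (fun t => h_trunc phi n (a + c * expi t)
    + fourier_coef phi (S n) * ((a + c * expi t) ^ S n * expi t ^ 0))).
  + intros t; rewrite (h_trunc_S phi n (a + c * expi t)) by exact H.
    change (expi t ^ 0) with (RtoC 1); ring.
  + rewrite (Cmult_comm (a ^ S n)).
    apply is_mean_plus; [exact IH|].
    apply is_mean_mult_l, (is_mean_pow_circle (S n) 0).
Qed.

Lemma continuous_h_kernel (z : C) (t : R) : (Cmod z < 1)%R ->
  continuous (fun s => z * expi (- s) / (1 - z * expi (- s))) t.
Proof.
intros Hz; apply continuous_Cmult; [apply continuous_mult_expi_opp|].
apply continuous_Cinv.
- apply one_minus_neq_0; rewrite Cmod_mult_expi; exact Hz.
- apply continuous_Cminus; [apply continuous_const|apply continuous_mult_expi_opp].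
Qed.

Lemma is_mean_h_of (phi : C -> R) (z : C) :
  continuous_boundary phi -> (Cmod z < 1)%R ->
  is_mean (fun t => z * expi (- t) / (1 - z * expi (- t)) * phi (expi t)) (h_of phi z).
Proof.
intros H Hz; apply is_mean_continuous; intros t.
apply continuous_Cmult; [apply continuous_h_kernel, Hz|apply continuous_RtoC, H].
Qed.

(** With [x = z e^(-it)] the integrands differ by [x^(n+1) / (1 - x)] times [phi]. Here [|x| = |z|]
    and [|1 - x| >= 1 - |z|], so the bound does not depend on [t]. *)
Lemma h_of_trunc_error (phi : C -> R) (M : R) (n : nat) (z : C) :
  continuous_boundary phi -> (forall t, Rabs (phi (expi t)) <= M)%R -> (Cmod z < 1)%R ->
  (Cmod (h_of phi z - h_trunc phi n z) <= Cmod z ^ S n / (1 - Cmod z) * M)%R.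
Proof.
intros H HM Hz.
apply (is_mean_Cmod_le_const _ _ _) with
  (2 := is_mean_minus _ _ _ _ (is_mean_h_of phi z H Hz) (is_mean_h_trunc phi n z H)).
intros t; set (x := z * expi (- t)).
assert (Hx : Cmod x = Cmod z) by apply Cmod_mult_expi.
assert (Hx1 : 1 - x <> 0) by (apply one_minus_neq_0; lra).
replace (x / (1 - x) * phi (expi t) - geom n x * phi (expi t))
  with ((x / (1 - x) - geom n x) * phi (expi t)) by ring.
rewrite geom_remainder by exact Hx1.
rewrite Cmod_mult, Cmod_R, Cmod_div, Cmod_pow, Hx by exact Hx1.
apply Rmult_le_compat; [|apply Rabs_pos| |apply HM].
- apply Rmult_le_pos; [apply pow_le, Cmod_ge_0|].
  apply Rlt_le, Rinv_0_lt_compat, Cmod_gt_0, Hx1.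
- apply Rmult_le_compat_l; [apply pow_le, Cmod_ge_0|].
  apply Rinv_le_contravar; [lra|].
  generalize (Cmod_one_minus_ge x); lra.
Qed.

Lemma is_lim_seq_trunc_error (q M : R) : (0 <= q < 1)%R ->
  is_lim_seq (fun n => q ^ S n / (1 - q) * M)%R 0%R.
Proof.
intros Hq.
replace (Finite 0) with (Rbar_mult 0%R (M / (1 - q))%R) by (simpl; f_equal; ring).
apply (is_lim_seq_ext (fun n => q ^ S n * (M / (1 - q)))%R);
  [intros n; unfold Rdiv; ring|].
apply is_lim_seq_scal_r.
apply (is_lim_seq_incr_1 (fun n => q ^ n)%R), is_lim_seq_geom.
rewrite Rabs_pos_eq; lra.
Qed.

(** Constant data have no Fourier coefficients of positive index, so every truncation vanishes and
    the error bound tends to zero. This is what gives the kernel mean [1]. *)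
Lemma h_of_one (z : C) : (Cmod z < 1)%R -> h_of (fun _ => 1%R) z = 0.
Proof.
intros Hz.
assert (Hc : continuous_boundary (fun _ => 1%R)) by (intros t; apply continuous_const).
assert (Hn : forall n, h_trunc (fun _ => 1%R) n z = 0).
{ induction n as [|n IH]; [apply h_trunc_0|].
  rewrite h_trunc_S, IH by exact Hc.
  replace (fourier_coef (fun _ => 1%R) (S n)) with (RtoC 0); [ring|].
  symmetry; apply is_mean_unique.
  apply (is_mean_ext (fun t => Cconj (expi t ^ S n))).
  - intros t; rewrite Cpow_conj, Cconj_expi; ring.
  - replace (RtoC 0) with (Cconj 0) by (unfold Cconj; simpl; now rewrite Ropp_0).
    apply is_mean_conj, is_mean_expi_pow. }
apply Cmod_eq_0, Rle_antisym; [|apply Cmod_ge_0].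
apply (is_lim_seq_le (fun _ => Cmod (h_of (fun _ => 1%R) z))
  (fun n => Cmod z ^ S n / (1 - Cmod z) * 1)%R
  (Cmod (h_of (fun _ => 1%R) z)) 0%R).
- intros n; pose proof (h_of_trunc_error (fun _ => 1%R) 1 n z Hc) as H.
  rewrite Hn in H; unfold Cminus in H; rewrite Copp_0, Cplus_0_r in H.
  apply H; [|exact Hz]; intros t; rewrite Rabs_R1; lra.
- apply is_lim_seq_const.
- apply is_lim_seq_trunc_error; split; [apply Cmod_ge_0|exact Hz].
Qed.

(** The last two summands of [poisson_kernel z w] are conjugate to each other, so the kernel is real
    and depends only on [x = z conj(w)]. *)
Definition real_poisson_kernel (x : C) : R := (1 + 2 * Re (x / (1 - x)))%R.

(** The classical closed form, from which both positivity and concentration are read. *)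
Lemma real_poisson_kernel_eq (x : C) : 1 - x <> 0 ->
  real_poisson_kernel x = ((1 - Cmod x ^ 2) / Cmod (1 - x) ^ 2)%R.
Proof.
intros H; unfold real_poisson_kernel.
assert (H1 : (Cmod (1 - x) ^ 2 <> 0)%R) by (apply pow_nonzero; apply Cmod_gt_0 in H; lra).
rewrite !Cmod2_alt in *; destruct x as [a b]; simpl in *; field.
intros H2; apply H1; lra.
Qed.

Lemma poisson_kernel_expi (z : C) (t : R) : (Cmod z < 1)%R ->
  poisson_kernel z (expi t) = RtoC (real_poisson_kernel (z * expi (- t))).
Proof.
intros Hz; unfold poisson_kernel, real_poisson_kernel.
rewrite Cconj_expi.
set (x := z * expi (- t)).
assert (Hx : 1 - x <> 0) by (apply one_minus_neq_0; unfold x; now rewrite Cmod_mult_expi).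
replace (Cconj z * expi t) with (Cconj x)
  by (unfold x; rewrite Cmult_conj, Cconj_expi, Ropp_involutive; reflexivity).
rewrite RtoC_plus, RtoC_mult, re_alt, Cdiv_conj by exact Hx.
rewrite Cminus_conj; replace (Cconj 1) with (RtoC 1)
  by (unfold Cconj; simpl; now rewrite Ropp_0).
field; split; [|exact Hx].
replace (1 - Cconj x) with (Cconj (1 - x))
 by (rewrite Cminus_conj; f_equal; unfold Cconj; simpl; now rewrite Ropp_0).
apply Cmod_gt_0; rewrite Cmod_conj; apply Cmod_gt_0, Hx.
Qed.

(** Written through [h_of], so that regularity is inherited from [h]; [is_mean_poisson_integral]
    recovers the integral against the kernel. *)
Definition poisson_integral (phi : C -> R) (z : C) : R := (a0 phi + 2 * Re (h_of phi z))%R.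

Lemma is_mean_poisson_integral (phi : C -> R) (z : C) :
  continuous_boundary phi -> (Cmod z < 1)%R ->
  is_mean (fun t => RtoC (real_poisson_kernel (z * expi (- t)) * phi (expi t)))
    (RtoC (poisson_integral phi z)).
Proof.
intros H Hz.
pose proof (is_mean_plus _ _ _ _ (is_mean_RtoC _ H)
  (is_mean_mult_l 2 _ _ (is_mean_Re _ _ (is_mean_h_of phi z H Hz)))) as Hm.
unfold poisson_integral; rewrite RtoC_plus, RtoC_mult.
refine (is_mean_ext _ _ _ _ Hm); intros t; cbv beta.
unfold real_poisson_kernel; rewrite re_scal_r, !RtoC_mult, RtoC_plus, RtoC_mult; ring.
Qed.

Lemma is_mean_real_poisson_kernel (z : C) : (Cmod z < 1)%R ->
  is_mean (fun t => RtoC (real_poisson_kernel (z * expi (- t)))) 1.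
Proof.
intros Hz.
assert (Hc : continuous_boundary (fun _ => 1%R)) by (intros t; apply continuous_const).
pose proof (is_mean_plus _ _ _ _ (is_mean_const 1)
  (is_mean_mult_l 2 _ _ (is_mean_Re _ _ (is_mean_h_of _ z Hc Hz)))) as Hm.
rewrite h_of_one in Hm by exact Hz.
rewrite re_RtoC, Cmult_0_r, Cplus_0_r in Hm.
refine (is_mean_ext _ _ _ _ Hm); intros t; cbv beta.
unfold real_poisson_kernel; rewrite re_scal_r, RtoC_plus, !RtoC_mult; ring.
Qed.

(** * Complex derivatives and partial derivatives *)

Lemma is_C_derive_iff (f : C -> C) (z l : C) :
  is_derive (K := C_AbsRing) (V := C_NormedModule) f z l <->
  forall e : R, (0 < e)%R -> exists d : R, (0 < d)%R /\
    forall y, (Cmod (y - z) < d)%R ->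
      (Cmod (f y - f z - (y - z) * l) <= e * Cmod (y - z))%R.
Proof.
split.
- intros [_ H] e He.
  destruct (H z (fun P HP => HP) (mkposreal e He)) as [d Hd].
  exists d; split; [apply cond_pos|]; intros y Hy; exact (Hd y Hy).
- intros H; split; [apply is_linear_scal_l|].
  intros x Hx e; rewrite <- (is_filter_lim_locally_unique (V := AbsRing_NormedModule C_AbsRing) z x Hx).
  destruct (H e (cond_pos e)) as [d [Hd0 Hd]].
  exists (mkposreal d Hd0); intros y Hy; exact (Hd y Hy).
Qed.

Lemma is_C_derive_quadratic (f : C -> C) (z l : C) (K d : R) : (0 < d)%R ->
  (forall y, Cmod (y - z) < d -> Cmod (f y - f z - (y - z) * l) <= K * Cmod (y - z) ^ 2)%R ->
  is_derive (K := C_AbsRing) (V := C_NormedModule) f z l.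
Proof.
intros Hd H; apply is_C_derive_iff; intros e He.
assert (HK : (0 < Rabs K + 1)%R) by (generalize (Rabs_pos K); lra).
exists (Rmin d (e / (Rabs K + 1))); split.
{ apply Rmin_pos; [exact Hd|]; apply Rdiv_lt_0_compat; assumption. }
intros y Hy.
assert (Hy1 := Rlt_le_trans _ _ _ Hy (Rmin_l _ _)).
assert (Hy2 := Rlt_le_trans _ _ _ Hy (Rmin_r _ _)).
apply Rle_trans with (1 := H y Hy1).
assert (H0 := Cmod_ge_0 (y - z)).
assert (H1 : ((Rabs K + 1) * Cmod (y - z) <= e)%R).
{ apply Rmult_le_reg_l with (/ (Rabs K + 1))%R; [apply Rinv_0_lt_compat, HK|].
  rewrite <- Rmult_assoc, Rinv_l by lra; unfold Rdiv in Hy2; lra. }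
apply Rle_trans with ((Rabs K + 1) * Cmod (y - z) * Cmod (y - z))%R.
- replace ((Rabs K + 1) * Cmod (y - z) * Cmod (y - z))%R
    with ((Rabs K + 1) * Cmod (y - z) ^ 2)%R by ring.
  apply Rmult_le_compat_r; [apply pow2_ge_0|generalize (Rle_abs K); lra].
- apply Rmult_le_compat_r; assumption.
Qed.

Lemma is_C_derive_affine (a b : C) (f : C -> C) (z l : C) :
  is_derive (K := C_AbsRing) (V := C_NormedModule) f z l ->
  is_derive (K := C_AbsRing) (V := C_NormedModule) (fun y => a + b * f y) z (b * l).
Proof.
intros Hf; apply is_C_derive_iff; intros e He.
assert (Hb := Cmod_ge_0 b).
destruct (proj1 (is_C_derive_iff f z l) Hf (e / (Cmod b + 1))%R) as [d [Hd0 Hd]].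
{ apply Rdiv_lt_0_compat; lra. }
exists d; split; [exact Hd0|]; intros y Hy; specialize (Hd y Hy).
replace (a + b * f y - (a + b * f z) - (y - z) * (b * l))
  with (b * (f y - f z - (y - z) * l)) by ring.
rewrite Cmod_mult.
assert (H0 := Cmod_ge_0 (y - z)).
apply Rle_trans with ((Cmod b + 1) * (e / (Cmod b + 1) * Cmod (y - z)))%R.
- apply Rmult_le_compat; [exact Hb|apply Cmod_ge_0|lra|exact Hd].
- right; field; lra.
Qed.

(** The complex numbers carry two uniform structures, by modulus (from [C_AbsRing]) and as a
    product; [locally_C] identifies their neighbourhoods. *)
Lemma is_C_derive_continuous (f : C -> C) (z l : C) :
  is_derive (K := C_AbsRing) (V := C_NormedModule) f z l -> continuous f z.
Proof.
intros H P HP.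
apply locally_C.
exact (ex_derive_continuous (K := C_AbsRing) (V := C_NormedModule) f z (ex_intro _ l H) P HP).
Qed.

Lemma locally_unit_disc (z : C) : unit_disc z ->
  locally (T := AbsRing_UniformSpace C_AbsRing) z unit_disc.
Proof.
intros Hz; apply (proj1 (unit_disc_Cmod z)) in Hz.
assert (Hd : (0 < 1 - Cmod z)%R) by lra.
exists (mkposreal _ Hd); intros y Hy; change C in y; apply (proj2 (unit_disc_Cmod _)).
assert (Hy1 : (Cmod (y - z) < 1 - Cmod z)%R) by exact Hy.
generalize (Cmod_triangle (y - z) z); replace (y - z + z) with y by ring; lra.
Qed.

(** All derivatives are supplied explicitly in advance, so regularity of every order reduces to a
    shift of the index. *)
Definition derivative_chain (D : C -> Prop) (G : nat -> C -> C) : Prop :=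
  forall n z, D z -> is_derive (K := C_AbsRing) (V := C_NormedModule) (G n) z (G (S n) z).

(** A derivative depends only on values near the point, and the disc is open, so equality on the
    disc survives each differentiation. *)
Lemma iter_C_derive_chain (G : nat -> C -> C) (f : C -> C) (n : nat) :
  derivative_chain unit_disc G -> (forall z, unit_disc z -> f z = G O z) ->
  forall z, unit_disc z -> Nat.iter n C_derive f z = G n z.
Proof.
intros HG Hf; induction n as [|n IH]; intros z Hz; [exact (Hf z Hz)|].
apply is_C_derive_unique.
apply (is_derive_ext_loc (K := C_AbsRing) (V := C_NormedModule) (G n)); [|apply HG, Hz].
apply (filter_imp unit_disc); [|apply locally_unit_disc, Hz].
intros y Hy; symmetry; apply IH, Hy.
Qed.

Lemma infinitely_C_differentiable_chain (G : nat -> C -> C) (f : C -> C) :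
  derivative_chain unit_disc G -> (forall z, unit_disc z -> f z = G O z) ->
  infinitely_C_differentiable_on unit_disc f.
Proof.
intros HG Hf n z Hz; exists (G (S n) z).
apply (is_derive_ext_loc (K := C_AbsRing) (V := C_NormedModule) (G n)); [|apply HG, Hz].
apply (filter_imp unit_disc); [|apply locally_unit_disc, Hz].
intros y Hy; symmetry; apply iter_C_derive_chain; assumption.
Qed.

(** The additive constant disappears after one differentiation, hence the separate case at index
    [0]. *)
Definition affine_chain (a b : C) (G : nat -> C -> C) (n : nat) (z : C) : C :=
  match n with
  | O => a + b * G O z
  | S _ => b * G n z
  end.

Lemma derivative_chain_affine (D : C -> Prop) (a b : C) (G : nat -> C -> C) :
  derivative_chain D G -> derivative_chain D (affine_chain a b G).
Proof.
intros HG [|n] z Hz.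
- apply is_C_derive_affine, HG, Hz.
- apply (is_derive_ext (K := C_AbsRing) (V := C_NormedModule) (fun y => 0 + b * G (S n) y)).
  + intros y; apply Cplus_0_l.
  + apply is_C_derive_affine, HG, Hz.
Qed.

(** The derivative of [f] in the direction [v] is [v l]. The directions [1] and [Ci] give the two
    partial derivatives, with the Cauchy-Riemann equations built in. *)
Lemma is_derive_Re_line (f : C -> C) (z l v : C) (t0 : R) : Cmod v = 1%R ->
  is_derive (K := C_AbsRing) (V := C_NormedModule) f z l ->
  is_derive (fun t : R => Re (f (z + RtoC (t - t0) * v))) t0 (Re (v * l)).
Proof.
intros Hv Hf; apply is_derive_Reals; intros e He.
(* Halving turns the weak inequality of the complex criterion into the strict one required of a real
   derivative. *)
destruct (proj1 (is_C_derive_iff f z l) Hf (e / 2)%R) as [d [Hd0 Hd]]; [lra|].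
exists (mkposreal d Hd0); intros s Hs0 Hs; simpl in Hs.
replace (t0 + s - t0)%R with s by ring; replace (t0 - t0)%R with 0%R by ring.
replace (z + RtoC 0 * v) with z by ring.
specialize (Hd (z + RtoC s * v)).
replace (z + RtoC s * v - z) with (RtoC s * v) in Hd by ring.
rewrite Cmod_mult, Hv, Cmod_R, Rmult_1_r in Hd.
specialize (Hd Hs).
apply (Rle_trans _ _ _ (re_le_Cmod _)) in Hd.
replace (Re (f (z + RtoC s * v) - f z - RtoC s * v * l))
  with (s * ((Re (f (z + RtoC s * v)%C) - Re (f z)) / s - Re (v * l)%C))%R in Hd.
- rewrite Rabs_mult, (Rmult_comm (e / 2)) in Hd.
  apply Rmult_le_reg_l in Hd; [|apply Rabs_pos_lt, Hs0].
  lra.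
- rewrite <- Cmult_assoc; unfold Cminus; rewrite !re_plus, !re_opp, re_scal_l; field; exact Hs0.
Qed.

Lemma locally_line_unit_disc (z v : C) (t0 : R) : Cmod v = 1%R -> unit_disc z ->
  locally t0 (fun t : R => unit_disc (z + RtoC (t - t0) * v)).
Proof.
intros Hv Hz; apply (proj1 (unit_disc_Cmod z)) in Hz.
assert (Hd : (0 < 1 - Cmod z)%R) by lra.
exists (mkposreal _ Hd); intros t Ht; apply (proj2 (unit_disc_Cmod _)).
assert (Ht1 : (Rabs (t - t0) < 1 - Cmod z)%R) by exact Ht.
apply Rle_lt_trans with (1 := Cmod_triangle _ _).
rewrite Cmod_mult, Hv, Cmod_R; lra.
Qed.

Lemma horizontal_line (z : C) (t : R) : (t, Im z) = z + RtoC (t - Re z) * 1.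
Proof. destruct z as [x y]; unfold Cplus, Cmult; simpl; f_equal; ring. Qed.

Lemma vertical_line (z : C) (t : R) : (Re z, t) = z + RtoC (t - Im z) * Ci.
Proof. destruct z as [x y]; unfold Cplus, Cmult; simpl; f_equal; ring. Qed.

Lemma is_derive_Re_chain_line (G : nat -> C -> C) (n : nat) (c v z : C) (f : C -> R) (t0 : R) :
  derivative_chain unit_disc G -> (forall y, unit_disc y -> f y = Re (c * G n y)) ->
  Cmod v = 1%R -> unit_disc z ->
  is_derive (fun t : R => f (z + RtoC (t - t0) * v)) t0 (Re (c * v * G (S n) z)).
Proof.
intros HG Hf Hv Hz.
apply (is_derive_ext_loc (fun t : R => Re (0 + c * G n (z + RtoC (t - t0) * v)))).
- apply (filter_imp (fun t : R => unit_disc (z + RtoC (t - t0) * v)));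
    [|apply locally_line_unit_disc; assumption].
  intros t Ht; rewrite Hf, Cplus_0_l by exact Ht; reflexivity.
- replace (c * v * G (S n) z) with (v * (c * G (S n) z)) by ring.
  apply (is_derive_Re_line (fun y => 0 + c * G n y)); [exact Hv|].
  apply is_C_derive_affine, HG, Hz.
Qed.

Lemma is_derive_x_Re_chain (G : nat -> C -> C) (n : nat) (c z : C) (f : C -> R) :
  derivative_chain unit_disc G -> (forall y, unit_disc y -> f y = Re (c * G n y)) ->
  unit_disc z ->
  is_derive (fun t : R => f (t, Im z)) (Re z) (Re (c * G (S n) z)).
Proof.
intros HG Hf Hz.
apply (is_derive_ext (fun t : R => f (z + RtoC (t - Re z) * 1))).
{ intros t; rewrite horizontal_line; reflexivity. }
rewrite <- (Cmult_1_r c).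
apply is_derive_Re_chain_line; try assumption; apply Cmod_1.
Qed.

Lemma is_derive_y_Re_chain (G : nat -> C -> C) (n : nat) (c z : C) (f : C -> R) :
  derivative_chain unit_disc G -> (forall y, unit_disc y -> f y = Re (c * G n y)) ->
  unit_disc z ->
  is_derive (fun t : R => f (Re z, t)) (Im z) (Re (c * Ci * G (S n) z)).
Proof.
intros HG Hf Hz.
apply (is_derive_ext (fun t : R => f (z + RtoC (t - Im z) * Ci))).
{ intros t; rewrite vertical_line; reflexivity. }
apply is_derive_Re_chain_line; try assumption; apply Cmod_Ci.
Qed.

Lemma Dx_Re_chain (G : nat -> C -> C) (n : nat) (c z : C) (f : C -> R) :
  derivative_chain unit_disc G -> (forall y, unit_disc y -> f y = Re (c * G n y)) ->
  unit_disc z -> Dx f z = Re (c * G (S n) z).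
Proof. intros HG Hf Hz; apply is_derive_unique, is_derive_x_Re_chain; assumption. Qed.

Lemma Dy_Re_chain (G : nat -> C -> C) (n : nat) (c z : C) (f : C -> R) :
  derivative_chain unit_disc G -> (forall y, unit_disc y -> f y = Re (c * G n y)) ->
  unit_disc z -> Dy f z = Re (c * Ci * G (S n) z).
Proof. intros HG Hf Hz; apply is_derive_unique, is_derive_y_Re_chain; assumption. Qed.

(** The functions [Re (c G_n)] are closed under partial derivatives: [Dx] raises [n], and [Dy] also
    multiplies [c] by [Ci]. Hence the induction on [k] runs over all [n], [c] and [f]. *)
Lemma Ck_on_Re_chain (G : nat -> C -> C) : derivative_chain unit_disc G ->
  forall k n (c : C) (f : C -> R),
  (forall z, unit_disc z -> f z = Re (c * G n z)) -> Ck_on k unit_disc f.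
Proof.
intros HG; assert (Hcont : forall n (c : C) (f : C -> R),
  (forall z, unit_disc z -> f z = Re (c * G n z)) -> continuous_on unit_disc f).
{ intros n c f Hf.
  apply (continuous_on_ext unit_disc (fun y => Re (c * G n y))).
  - intros y Hy; symmetry; apply Hf, Hy.
  - apply continuous_on_forall; intros z Hz.
    apply (continuous_Re (fun y => c * G n y)), continuous_Cmult; [apply continuous_const|].
    apply (is_C_derive_continuous _ _ _ (HG n z Hz)). }
intros k; induction k as [|k IH]; intros n c f Hf; (split; [exact (Hcont n c f Hf)|]).
- exact I.
- split; [|split].
  + intros z Hz; split.
    * eexists; apply (is_derive_x_Re_chain G n c); assumption.
    * eexists; apply (is_derive_y_Re_chain G n c); assumption.
  + apply (IH (S n) c); intros z Hz; apply Dx_Re_chain; assumption.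
  + apply (IH (S n) (c * Ci)); intros z Hz; apply Dy_Re_chain; assumption.
Qed.

(** The two derivatives in [y] contribute [Ci * Ci = -1], which cancels the two in [x]. *)
Lemma laplacian_Re_chain (G : nat -> C -> C) (c z : C) (f : C -> R) :
  derivative_chain unit_disc G -> (forall y, unit_disc y -> f y = Re (c * G O y)) ->
  unit_disc z -> laplacian f z = 0%R.
Proof.
intros HG Hf Hz; unfold laplacian.
rewrite (Dx_Re_chain G 1 c), (Dy_Re_chain G 1 (c * Ci)); try assumption.
- replace (c * Ci * Ci * G 2%nat z) with (- (c * G 2%nat z)).
  + rewrite re_opp; ring.
  + replace (c * Ci * Ci) with (c * (Ci * Ci)) by ring.
    replace (Ci * Ci) with (RtoC (-1)); [ring|].
    unfold Ci, Cmult, RtoC; simpl; f_equal; ring.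
- intros y Hy; apply Dy_Re_chain; assumption.
- intros y Hy; apply Dx_Re_chain; assumption.
Qed.

(** * Poisson formula *)

(** Meant for [A = 1/(1 - y c)], [B = 1/(1 - z c)], [d = y - z], where the hypothesis on [A - B] is
    the resolvent identity. In the induction the old error is multiplied by [A], and using the
    identity twice leaves [(n+1) d^2 c^2 A B^(n+2)]. Only [n] and [M] enter [K], so the estimate can
    be averaged over [c]. *)
Lemma resolvent_pow_quadratic (n : nat) (M : R) : (0 <= M)%R ->
  exists K : R, (0 <= K)%R /\ forall A B c d : C,
    A - B = d * c * A * B -> Cmod c = 1%R -> (Cmod A <= M)%R -> (Cmod B <= M)%R ->
    (Cmod (A ^ n - B ^ n - RtoC (INR n) * d * c * B ^ S n) <= K * Cmod d ^ 2)%R.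
Proof.
intros HM; induction n as [|n [K [HK IH]]].
- exists 0%R; split; [lra|]; intros A B c d _ _ _ _.
  replace (A ^ 0 - B ^ 0 - RtoC (INR 0) * d * c * B ^ 1) with (RtoC 0) by (simpl; ring).
  rewrite Cmod_0; lra.
- exists (M * K + INR (S n) * (M * M ^ S (S n)))%R; split.
  { assert (0 <= INR (S n))%R by apply pos_INR.
    assert (0 <= M ^ S (S n))%R by (apply pow_le, HM).
    assert (0 <= M * M ^ S (S n))%R by (apply Rmult_le_pos; assumption).
    nra. }
  intros A B c d HAB Hc HA HB; specialize (IH A B c d HAB Hc HA HB).
  assert (E : A ^ S n - B ^ S n - RtoC (INR (S n)) * d * c * B ^ S (S n)
    = A * (A ^ n - B ^ n - RtoC (INR n) * d * c * B ^ S n)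
      + RtoC (INR (S n)) * (d ^ 2 * c ^ 2 * (A * B ^ S (S n)))).
  { replace (A * (A ^ n - B ^ n - RtoC (INR n) * d * c * B ^ S n))
      with (A * (A ^ n - B ^ n) - RtoC (INR n) * d * c * B ^ S n * (B + (A - B))) by ring.
    replace (A * (A ^ n - B ^ n)) with (A ^ S n - B ^ S n - B ^ n * (A - B))
      by (rewrite !Cpow_S; ring).
    rewrite HAB.
    replace (B ^ n * (d * c * A * B)) with (d * c * B * B ^ n * (B + (A - B))) by ring.
    rewrite HAB, S_INR, RtoC_plus, !Cpow_S; ring. }
  rewrite E.
  apply Rle_trans with (1 := Cmod_triangle _ _).
  rewrite Rmult_plus_distr_r; apply Rplus_le_compat.
  + rewrite Cmod_mult, Rmult_assoc.
    apply Rmult_le_compat; [apply Cmod_ge_0|apply Cmod_ge_0|exact HA|exact IH].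
  + rewrite !Cmod_mult, !Cmod_pow, Hc, Cmod_R, Rabs_pos_eq, pow1, Rmult_1_r by apply pos_INR.
    rewrite Rmult_assoc, (Rmult_comm (Cmod d ^ 2)).
    apply Rmult_le_compat_l; [apply pos_INR|].
    apply Rmult_le_compat_r; [apply pow_le, Cmod_ge_0|].
    apply Rmult_le_compat; [apply Cmod_ge_0|apply pow_le, Cmod_ge_0|exact HA|].
    apply pow_incr; split; [apply Cmod_ge_0|exact HB].
Qed.

(* The [n]-th derivative of [z |-> 1/(1 - z c)] is [n! c^n / (1 - z c)^(n+1)],
   here with [c = e^(-it)] and averaged against [phi]. *)
Definition cauchy_integral (phi : C -> R) (n : nat) (z : C) : C :=
  RtoC (INR (fact n)) *
  angular_mean (fun t => expi (- t) ^ n * (/ (1 - z * expi (- t))) ^ S n * phi (expi t)).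

Lemma is_mean_cauchy_integral (phi : C -> R) (n : nat) (z : C) :
  continuous_boundary phi -> (Cmod z < 1)%R ->
  is_mean (fun t => RtoC (INR (fact n)) *
    (expi (- t) ^ n * (/ (1 - z * expi (- t))) ^ S n * phi (expi t))) (cauchy_integral phi n z).
Proof.
intros H Hz; apply is_mean_mult_l, is_mean_continuous; intros t.
apply continuous_Cmult; [|apply continuous_RtoC, H].
apply continuous_Cmult; [apply continuous_Cpow, continuous_expi_opp|].
apply continuous_Cpow, continuous_Cinv.
- apply one_minus_neq_0; rewrite Cmod_mult_expi; exact Hz.
- apply continuous_Cminus; [apply continuous_const|apply continuous_mult_expi_opp].
Qed.

Lemma Cmod_resolvent_le (z : C) (t d : R) : (0 < d)%R -> (Cmod z <= 1 - d)%R ->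
  1 - z * expi t <> 0 /\ (Cmod (/ (1 - z * expi t)) <= / d)%R.
Proof.
intros Hd Hz.
assert (H0 : 1 - z * expi t <> 0) by (apply one_minus_neq_0; rewrite Cmod_mult_expi; lra).
split; [exact H0|].
rewrite Cmod_inv by exact H0.
apply Rinv_le_contravar; [exact Hd|].
generalize (Cmod_one_minus_ge (z * expi t)); rewrite Cmod_mult_expi; lra.
Qed.

(** For [d = (1 - |z|) / 2] and [|y - z| < d] both points have modulus at most [1 - d], so both
    resolvents are bounded by [1 / d] for every [t]. The pointwise quadratic error then passes to
    the mean. *)
Lemma derivative_chain_cauchy_integral (phi : C -> R) (M : R) :
  continuous_boundary phi -> (forall t, Rabs (phi (expi t)) <= M)%R ->
  derivative_chain unit_disc (cauchy_integral phi).
Proof.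
intros H HM n z Hz; apply (proj1 (unit_disc_Cmod z)) in Hz.
set (d := ((1 - Cmod z) / 2)%R).
assert (Hd : (0 < d)%R) by (unfold d; lra).
destruct (resolvent_pow_quadratic (S n) (/ d)) as [K [HK HQ]].
{ apply Rlt_le, Rinv_0_lt_compat, Hd. }
apply (is_C_derive_quadratic _ _ _ (INR (fact n) * (K * M)) d Hd); intros y Hy.
assert (Hy1 : (Cmod y <= 1 - d)%R).
{ generalize (Cmod_triangle (y - z) z); replace (y - z + z) with y by ring; unfold d in *; lra. }
apply (is_mean_Cmod_le_const _ _ _) with (2 := is_mean_minus _ _ _ _
  (is_mean_minus _ _ _ _ (is_mean_cauchy_integral phi n y H ltac:(lra))
                         (is_mean_cauchy_integral phi n z H Hz))
  (is_mean_mult_l (y - z) _ _ (is_mean_cauchy_integral phi (S n) z H Hz))).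
intros t.
destruct (Cmod_resolvent_le y (- t) d Hd Hy1) as [HA0 HA].
destruct (Cmod_resolvent_le z (- t) d Hd ltac:(unfold d; lra)) as [HB0 HB].
set (c := expi (- t)) in *.
assert (Hc : Cmod c = 1%R) by apply Cmod_expi.
assert (HAB : / (1 - y * c) - / (1 - z * c) = (y - z) * c * / (1 - y * c) * / (1 - z * c))
  by (field; split; assumption).
set (A := / (1 - y * c)) in *; set (B := / (1 - z * c)) in *.
specialize (HQ A B c (y - z) HAB Hc HA HB).
replace (INR (fact n) * (c ^ n * A ^ S n * phi (expi t)) -
   INR (fact n) * (c ^ n * B ^ S n * phi (expi t)) -
   (y - z) * (INR (fact (S n)) * (c ^ S n * B ^ S (S n) * phi (expi t))))
  with (INR (fact n) * (c ^ n *
     (A ^ S n - B ^ S n - RtoC (INR (S n)) * (y - z) * c * B ^ S (S n)) * phi (expi t))).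
2: { rewrite fact_simpl, mult_INR, RtoC_mult, (Cpow_S c n); ring. }
rewrite !Cmod_mult, Cmod_pow, Hc, pow1, Rmult_1_l, !Cmod_R, (Rabs_pos_eq (INR _)) by apply pos_INR.
rewrite Rmult_assoc.
apply Rmult_le_compat_l; [apply pos_INR|].
replace (K * M * Cmod (y - z) ^ 2)%R with (K * Cmod (y - z) ^ 2 * M)%R by ring.
apply Rmult_le_compat; [apply Cmod_ge_0|apply Rabs_pos|exact HQ|apply HM].
Qed.

(** The average of [x / (1 - x) = 1 / (1 - x) - 1] against [phi]. *)
Lemma h_of_cauchy_integral (phi : C -> R) (z : C) :
  continuous_boundary phi -> (Cmod z < 1)%R ->
  h_of phi z = - RtoC (a0 phi) + cauchy_integral phi 0 z.
Proof.
intros H Hz; apply is_mean_unique.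
pose proof (is_mean_plus _ _ _ _ (is_mean_mult_l (-1) _ _ (is_mean_RtoC _ H))
  (is_mean_cauchy_integral phi 0 z H Hz)) as Hm.
replace (- RtoC (a0 phi)) with (-1 * RtoC (a0 phi)) by ring.
refine (is_mean_ext _ _ _ _ Hm); intros t; simpl; field.
apply one_minus_neq_0; rewrite Cmod_mult_expi; exact Hz.
Qed.

(** * Boundary behaviour of the Poisson integral *)

Lemma real_poisson_kernel_nonneg (x : C) : (Cmod x < 1)%R -> (0 <= real_poisson_kernel x)%R.
Proof.
intros Hx; assert (H0 := one_minus_neq_0 x Hx).
rewrite real_poisson_kernel_eq by exact H0.
assert (H1 := Cmod_ge_0 x); apply Cmod_gt_0 in H0.
apply Rmult_le_pos; [nra|].
apply Rlt_le, Rinv_0_lt_compat, pow_lt, H0.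
Qed.

(* The kernel concentrates at [w]: [|e^(it) - w| <= |e^(it) - r w| + (1 - r)
   <= 2 |e^(it) - r w|], and [|e^(it) - r w|^2] is the denominator of the kernel. *)
Lemma real_poisson_kernel_concentrates (r : R) (w : C) (t : R) :
  (0 <= r < 1)%R -> unit_circle w ->
  (real_poisson_kernel (RtoC r * w * expi (- t)) * Cmod (expi t - w) ^ 2 <= 4 * (1 - r ^ 2))%R.
Proof.
intros Hr Hw; unfold unit_circle in Hw.
set (x := RtoC r * w * expi (- t)).
assert (Hx : Cmod x = r).
{ unfold x; rewrite Cmod_mult_expi, Cmod_mult, Hw, Cmod_R, Rabs_pos_eq; lra. }
assert (H0 : 1 - x <> 0) by (apply one_minus_neq_0; lra).
rewrite real_poisson_kernel_eq, Hx by exact H0.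
assert (HD1 := Cmod_one_minus_ge x); rewrite Hx in HD1.
assert (Hee : expi (- t) * expi t = 1).
{ rewrite <- Cconj_expi, Cmult_comm, <- Cmod2_conj, Cmod_expi; apply f_equal; ring. }
assert (HD2 : (Cmod (expi t - w) <= Cmod (1 - x) + (1 - r))%R).
{ replace (expi t - w) with ((1 - x) * expi t + - (RtoC (1 - r) * w)).
  - apply Rle_trans with (1 := Cmod_triangle _ _).
    rewrite Cmod_opp, Cmod_mult_expi, Cmod_mult, Hw, Cmod_R, Rabs_pos_eq; lra.
  - unfold x; replace ((1 - RtoC r * w * expi (- t)) * expi t)
      with (expi t - RtoC r * w * (expi (- t) * expi t)) by ring.
    rewrite Hee, RtoC_minus; ring. }
set (D := Cmod (1 - x)) in *.
assert (HD : (0 < D)%R) by lra.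
assert (H2 : (Cmod (expi t - w) ^ 2 <= 4 * D ^ 2)%R).
{ replace (4 * D ^ 2)%R with ((2 * D) ^ 2)%R by ring.
  apply pow_incr; split; [apply Cmod_ge_0|lra]. }
apply Rle_trans with ((1 - r ^ 2) / D ^ 2 * (4 * D ^ 2))%R.
- apply Rmult_le_compat_l; [|exact H2].
  apply Rmult_le_pos; [nra|apply Rlt_le, Rinv_0_lt_compat, pow_lt, HD].
- right; field; lra.
Qed.

(** As the kernel has mean [1], the difference is the mean of the kernel times [phi - phi w].
    Positivity lets the hypothesis enter: the part [e] integrates to [e], and the quadratic part is
    at most [4 c (1 - r^2)] at every [t]. *)
Lemma poisson_integral_near_boundary (phi : C -> R) (e c r : R) (w : C) :
  continuous_boundary phi ->
  (forall t, Rabs (phi (expi t) - phi w) <= e + c * Cmod (expi t - w) ^ 2)%R ->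
  (0 <= c)%R -> (0 <= r < 1)%R -> unit_circle w ->
  (Rabs (poisson_integral phi (RtoC r * w) - phi w) <= e + 4 * c * (1 - r ^ 2))%R.
Proof.
intros H Hphi Hc Hr Hw.
assert (Hz : (Cmod (RtoC r * w) < 1)%R).
{ rewrite Cmod_mult, Cmod_R, Rabs_pos_eq, Hw by lra; lra. }
rewrite <- Cmod_R, RtoC_minus.
replace (RtoC (phi w)) with (RtoC (phi w) * 1) by ring.
pose proof (is_mean_real_poisson_kernel _ Hz) as HK.
refine (is_mean_Cmod_le _
  (fun t => real_poisson_kernel (RtoC r * w * expi (- t)) * e + 4 * c * (1 - r ^ 2))%R _ _ _
  (is_mean_minus _ _ _ _ (is_mean_poisson_integral phi _ H Hz) (is_mean_mult_l (phi w) _ _ HK)) _).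
- intros t; cbv beta; set (k := real_poisson_kernel _).
  rewrite <- RtoC_mult, <- RtoC_minus, Cmod_R.
  replace (k * phi (expi t) - phi w * k)%R with (k * (phi (expi t) - phi w))%R by ring.
  assert (Hk : (0 <= k)%R).
  { apply real_poisson_kernel_nonneg; rewrite Cmod_mult_expi; exact Hz. }
  rewrite Rabs_mult, Rabs_pos_eq by exact Hk.
  apply Rle_trans with (1 := Rmult_le_compat_l _ _ _ Hk (Hphi t)).
  pose proof (Rmult_le_compat_l _ _ _ Hc (real_poisson_kernel_concentrates r w t Hr Hw)) as H1.
  fold k in H1; lra.
- pose proof (is_mean_plus _ _ _ _ (is_mean_mult_l e _ _ HK)
    (is_mean_const (RtoC (4 * c * (1 - r ^ 2))))) as Hm.
  rewrite Cmult_1_r, <- RtoC_plus in Hm.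
  refine (is_mean_ext _ _ _ _ Hm); intros t; cbv beta.
  rewrite RtoC_plus, (RtoC_mult _ e); ring.
Qed.

Lemma closed_unit_disc_circle (z : C) : unit_circle z -> closed_unit_disc z.
Proof. intros H; unfold closed_unit_disc; rewrite H; lra. Qed.

(** Closer than [d], uniform continuity gives [e]. Otherwise the oscillation is at most [2 M], and
    [2 M <= (2 M / d^2) |z - w|^2]. *)
Lemma quadratic_modulus_on_circle (v : C -> R) (e : posreal) :
  continuous_on closed_unit_disc v ->
  exists c : R, (0 <= c)%R /\ forall z w, unit_circle z -> unit_circle w ->
    (Rabs (v z - v w) <= e + c * Cmod (z - w) ^ 2)%R.
Proof.
intros Hv.
destruct (continuous_on_closed_disc_bounded v Hv) as [M HM].
destruct (continuous_on_closed_disc_unif v e Hv) as [d Hd].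
assert (Hd0 := cond_pos d).
assert (HM0 : (0 <= M)%R).
{ apply Rle_trans with (1 := Rabs_pos (v 0)), HM; unfold closed_unit_disc; rewrite Cmod_0; lra. }
exists (2 * M / d ^ 2)%R; split.
{ apply Rmult_le_pos; [lra|apply Rlt_le, Rinv_0_lt_compat, pow_lt, Hd0]. }
intros z w Hz Hw; apply closed_unit_disc_circle in Hz, Hw.
assert (H0 := Cmod_ge_0 (z - w)).
destruct (Rlt_le_dec (Cmod (z - w)) d) as [Hlt|Hge].
- assert (0 <= 2 * M / d ^ 2 * Cmod (z - w) ^ 2)%R.
  { apply Rmult_le_pos; [|apply pow2_ge_0].
    apply Rmult_le_pos; [lra|apply Rlt_le, Rinv_0_lt_compat, pow_lt, Hd0]. }
  generalize (Hd w z Hw Hz Hlt); lra.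
- assert (2 * M <= 2 * M / d ^ 2 * Cmod (z - w) ^ 2)%R.
  { apply Rle_trans with (2 * M / d ^ 2 * d ^ 2)%R; [right; field; lra|].
    apply Rmult_le_compat_l.
    - apply Rmult_le_pos; [lra|apply Rlt_le, Rinv_0_lt_compat, pow_lt, Hd0].
    - apply pow_incr; lra. }
  generalize (Rabs_triang (v z) (- v w)) (HM z Hz) (HM w Hw) (cond_pos e).
  rewrite Rabs_Ropp; unfold Rminus; lra.
Qed.

(** * Identification of the Dirichlet solution with the Poisson integral *)

Lemma harmonic_ave_mean_value (v : C -> R) :
  harmonic_ave unit_disc (fun z => RtoC (v z)) -> continuous_on closed_unit_disc v ->
  mean_value_on_unit_disc v.
Proof.
intros [_ [_ H]] Hc a r Hr Har; rewrite (H a r Hr).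
- apply is_mean_continuous; intros t; apply continuous_RtoC.
  (* The circle lies in the closed disc, where the retraction is the identity, so [v] may be
     replaced by its continuous extension. *)
  apply (continuous_ext (fun t => v (radial_retraction (a + RtoC r * expi t)))).
  + intros s; rewrite radial_retraction_id; [reflexivity|].
    unfold closed_unit_disc; apply Rle_trans with (1 := Cmod_triangle _ _).
    rewrite Cmod_mult_expi, Cmod_R, Rabs_pos_eq; lra.
  + apply (continuous_comp (fun t => a + RtoC r * expi t)
      (fun z => v (radial_retraction z))).
    * apply continuous_Cplus; [apply continuous_const|].
      apply continuous_Cmult; [apply continuous_const|apply continuous_expi].
    * apply continuous_comp_radial_retraction, Hc.
- intros z Hz; change C in z; apply (proj2 (unit_disc_Cmod z)).
  set (e := (1 - Cmod a - r)%R).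
  (* Balls of the product structure are squares; half-side [e / sqrt 2] puts the square inside the
     disc of radius [e], the gap between the closed disc and the unit circle. *)
  assert (He : (0 < e / sqrt 2)%R) by (apply Rdiv_lt_0_compat; [unfold e; lra|apply Rlt_sqrt2_0]).
  destruct (Hz (ball z (mkposreal _ He)) (locally_ball _ _)) as [y [Hy1 Hy2]]; change C in y.
  apply C_NormedModule_mixin_compat2 in Hy1; simpl in Hy1.
  replace (sqrt 2 * (e / sqrt 2))%R with e in Hy1 by (field; generalize Rlt_sqrt2_0; lra).
  change (minus y z) with (y - z) in Hy1; unfold open_disc in Hy2.
  generalize (Cmod_triangle (- (y - z)) (y - a)) (Cmod_triangle (- (y - z) + (y - a)) a).
  replace (- (y - z) + (y - a) + a) with z by ring; rewrite Cmod_opp; unfold e in Hy1; lra.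
Qed.

Lemma mean_value_on_unit_disc_trunc (phi : C -> R) (n : nat) (r : R) :
  continuous_boundary phi ->
  mean_value_on_unit_disc (fun z => a0 phi + 2 * Re (h_trunc phi n (RtoC r * z)))%R.
Proof.
intros H a s _ _.
pose proof (is_mean_plus _ _ _ _ (is_mean_const (RtoC (a0 phi)))
  (is_mean_mult_l 2 _ _ (is_mean_Re _ _
    (is_mean_h_trunc_circle phi n (RtoC r * a) (RtoC r * RtoC s) H)))) as Hm.
rewrite RtoC_plus, RtoC_mult.
refine (is_mean_ext _ _ _ _ Hm); intros t; cbv beta.
rewrite RtoC_plus, RtoC_mult.
replace (RtoC r * (a + RtoC s * expi t)) with (RtoC r * a + RtoC r * RtoC s * expi t) by ring.
reflexivity.
Qed.

Lemma mean_value_on_unit_disc_linear (c : R) (v w : C -> R) :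
  mean_value_on_unit_disc v -> mean_value_on_unit_disc w ->
  mean_value_on_unit_disc (fun z => c * (v z - w z))%R.
Proof.
intros Hv Hw a r Hr Har.
pose proof (is_mean_mult_l c _ _ (is_mean_minus _ _ _ _ (Hv a r Hr Har) (Hw a r Hr Har))) as Hm.
rewrite RtoC_mult, RtoC_minus.
refine (is_mean_ext _ _ _ _ Hm); intros t; cbv beta.
rewrite RtoC_mult, RtoC_minus; reflexivity.
Qed.

Lemma continuous_trunc (phi : C -> R) (n : nat) (r : R) (z : C) :
  continuous_boundary phi ->
  continuous (fun z => a0 phi + 2 * Re (h_trunc phi n (RtoC r * z)))%R z.
Proof.
intros H.
apply (continuous_plus (V := R_NormedModule)); [apply continuous_const|].
apply (continuous_mult (K := R_AbsRing)); [apply continuous_const|].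
apply (continuous_Re (fun z => h_trunc phi n (RtoC r * z))).
apply (continuous_comp (fun z => RtoC r * z) (h_trunc phi n)).
- apply continuous_Cmult; [apply continuous_const|apply continuous_id].
- apply continuous_h_trunc, H.
Qed.

(** The maximum principle is one-sided; it is applied to [c (v - w)] with [c = 1] and [c = -1]. *)
Lemma mean_value_comparison (v w : C -> R) (m : R) :
  continuous_on closed_unit_disc v -> continuous_on closed_unit_disc w ->
  mean_value_on_unit_disc v -> mean_value_on_unit_disc w ->
  (forall z, unit_circle z -> Rabs (v z - w z) <= m)%R ->
  forall z, closed_unit_disc z -> (Rabs (v z - w z) <= m)%R.
Proof.
intros Hv Hw Mv Mw Hb z Hz.
assert (Hcont : forall c, continuous_on closed_unit_disc (fun z => c * (v z - w z))%R).
{ intros c.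
  apply (continuous_on_ext closed_unit_disc (fun z => (c * v z) + (- c * w z))%R).
  { intros y _; change (c * v y + - c * w y = c * (v y - w y))%R; ring. }
  assert (Hm : forall d f, continuous_on closed_unit_disc f ->
    continuous_on closed_unit_disc (fun z => d * f z)%R).
  { intros d f Hf y Hy.
    apply (filterlim_comp _ _ _ f (fun x => d * x)%R _ (locally (f y))); [apply Hf, Hy|].
    apply (continuous_mult (K := R_AbsRing)); [apply continuous_const|apply continuous_id]. }
  apply continuous_on_Rplus; apply Hm; assumption. }
assert (Hs : forall c, (Rabs c <= 1)%R -> (c * (v z - w z) <= m)%R).
{ intros c Hc.
  refine (mean_value_max_principle (fun z => c * (v z - w z))%R m (Hcont c)
    (mean_value_on_unit_disc_linear c v w Mv Mw) _ z Hz).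
  intros y Hy; apply Rle_trans with (1 := Rle_abs _).
  rewrite Rabs_mult; generalize (Hb y Hy) (Rabs_pos (v y - w y)) (Rabs_pos c); nra. }
assert (H1 := Hs 1%R ltac:(rewrite Rabs_R1; lra)).
assert (H2 := Hs (-1)%R ltac:(rewrite Rabs_m1; lra)).
apply Rabs_le; lra.
Qed.

Lemma Cmod_RtoC_mult_le (r : R) (z : C) :
  (0 <= r < 1)%R -> closed_unit_disc z -> (Cmod (RtoC r * z) <= r)%R.
Proof.
intros Hr Hz; unfold closed_unit_disc in Hz.
rewrite Cmod_mult, Cmod_R, Rabs_pos_eq by lra; generalize (Cmod_ge_0 z); nra.
Qed.

Lemma poisson_integral_trunc_error (phi : C -> R) (M r : R) (n : nat) (z : C) :
  continuous_boundary phi -> (forall t, Rabs (phi (expi t)) <= M)%R ->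
  (0 <= r < 1)%R -> (Cmod z <= r)%R ->
  (Rabs (poisson_integral phi z - (a0 phi + 2 * Re (h_trunc phi n z)))
    <= 2 * (r ^ S n / (1 - r) * M))%R.
Proof.
intros H HM Hr Hz; unfold poisson_integral.
replace (a0 phi + 2 * Re (h_of phi z) - (a0 phi + 2 * Re (h_trunc phi n z)))%R
  with (2 * Re (h_of phi z - h_trunc phi n z)%C)%R
  by (unfold Cminus; rewrite re_plus, re_opp; ring).
rewrite Rabs_mult, (Rabs_pos_eq 2) by lra.
apply Rmult_le_compat_l; [lra|].
apply Rle_trans with (1 := re_le_Cmod _).
apply Rle_trans with (1 := h_of_trunc_error phi M n z H HM ltac:(lra)).
assert (H0 := Cmod_ge_0 z).
apply Rmult_le_compat_r; [exact (Rle_trans _ _ _ (Rabs_pos _) (HM 0%R))|].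
apply Rmult_le_compat; [apply pow_le, H0| |apply pow_incr; lra|apply Rinv_le_contravar; lra].
apply Rlt_le, Rinv_0_lt_compat; lra.
Qed.

Lemma continuous_poisson_integral (phi : C -> R) (M : R) (z : C) :
  continuous_boundary phi -> (forall t, Rabs (phi (expi t)) <= M)%R ->
  (Cmod z < 1)%R -> continuous (poisson_integral phi) z.
Proof.
intros H HM Hz.
apply (continuous_ext_loc _
  (fun y => a0 phi + 2 * Re (- RtoC (a0 phi) + cauchy_integral phi 0 y))%R).
- apply (filter_imp unit_disc).
  + intros y Hy; apply (proj1 (unit_disc_Cmod y)) in Hy.
    unfold poisson_integral; rewrite h_of_cauchy_integral by assumption; reflexivity.
  + apply locally_C, locally_unit_disc, (proj2 (unit_disc_Cmod z)), Hz.
- apply (continuous_plus (V := R_NormedModule)); [apply continuous_const|].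
  apply (continuous_mult (K := R_AbsRing)); [apply continuous_const|].
  apply (continuous_Re (fun y => - RtoC (a0 phi) + cauchy_integral phi 0 y)).
  apply continuous_Cplus; [apply continuous_const|].
  apply (is_C_derive_continuous _ _ (cauchy_integral phi 1 z)).
  apply (derivative_chain_cauchy_integral phi M H HM), (proj2 (unit_disc_Cmod z)), Hz.
Qed.

(* The mean value property of [z |-> poisson_integral phi (r z)] would need
   Fubini; its truncations are harmonic polynomials and converge uniformly. *)
Lemma dilated_poisson_integral_close (phi u : C -> R) (e r : R) :
  continuous_boundary phi -> dirichlet_solution phi u -> (0 <= r < 1)%R ->
  (forall w, unit_circle w -> Rabs (poisson_integral phi (RtoC r * w) - phi w) <= e)%R ->
  forall z, closed_unit_disc z -> (Rabs (u z - poisson_integral phi (RtoC r * z)) <= e)%R.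
Proof.
intros H [Hu [Hharm Hb]] Hr He z Hz.
destruct (continuous_on_closed_disc_bounded u Hu) as [M HM].
assert (HM' : forall t, (Rabs (phi (expi t)) <= M)%R).
{ intros t; rewrite <- Hb by apply unit_circle_expi.
  apply HM, closed_unit_disc_circle, unit_circle_expi. }
set (err := fun n => (2 * (r ^ S n / (1 - r) * M))%R).
(* One [err n] is spent replacing the Poisson integral by its truncation on the circle, the other in
   returning to it at [z]. *)
assert (Hn : forall n, (Rabs (u z - poisson_integral phi (RtoC r * z)) <= e + 2 * err n)%R).
{ intros n.
  set (S_n := fun z => (a0 phi + 2 * Re (h_trunc phi n (RtoC r * z)))%R).
  assert (HS : forall w, closed_unit_disc w ->
    (Rabs (poisson_integral phi (RtoC r * w) - S_n w) <= err n)%R).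
  { intros w Hw; apply poisson_integral_trunc_error; try assumption.
    apply Cmod_RtoC_mult_le; assumption. }
  assert (H1 : (Rabs (u z - S_n z) <= e + err n)%R).
  { apply (mean_value_comparison u S_n); try assumption.
    - apply continuous_on_forall; intros w _; apply continuous_trunc, H.
    - apply harmonic_ave_mean_value; assumption.
    - apply mean_value_on_unit_disc_trunc, H.
    - intros w Hw; rewrite Hb by exact Hw.
      replace (phi w - S_n w)%R with (- (poisson_integral phi (RtoC r * w) - phi w)
        + (poisson_integral phi (RtoC r * w) - S_n w))%R by ring.
      apply Rle_trans with (1 := Rabs_triang _ _); rewrite Rabs_Ropp.
      apply Rplus_le_compat; [apply He, Hw|apply HS, closed_unit_disc_circle, Hw]. }
  replace (u z - poisson_integral phi (RtoC r * z))%R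
    with ((u z - S_n z) + - (poisson_integral phi (RtoC r * z) - S_n z))%R by ring.
  apply Rle_trans with (1 := Rabs_triang _ _); rewrite Rabs_Ropp.
  generalize (HS z Hz); lra. }
apply (is_lim_seq_le (fun _ => Rabs (u z - poisson_integral phi (RtoC r * z)))
  (fun n => e + 2 * err n)%R (Rabs (u z - poisson_integral phi (RtoC r * z))) e Hn).
- apply is_lim_seq_const.
- replace (Finite e) with (Finite (e + 2 * (2 * 0))%R) by (apply f_equal; ring).
  apply is_lim_seq_plus'; [apply is_lim_seq_const|].
  apply (is_lim_seq_scal_l _ 2%R (Finite (2 * 0)%R)).
  apply (is_lim_seq_scal_l _ 2%R (Finite 0)).
  apply is_lim_seq_trunc_error, Hr.
Qed.

(** Three errors below [e] in total: [e / 4] from the modulus of continuity, less than [e / 4] from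
    [4 c (1 - r^2)], and less than [e / 4] from continuity of the Poisson integral at [z]. The
    radius [r = 1 - 2^(-n)] is fixed last, because [c] depends on [e]. *)
Lemma dirichlet_solution_poisson_integral (phi u : C -> R) (z : C) :
  continuous_boundary phi -> dirichlet_solution phi u -> (Cmod z < 1)%R ->
  u z = poisson_integral phi z.
Proof.
intros H Hsol Hz.
pose proof Hsol as [Hu [_ Hb]].
destruct (continuous_on_closed_disc_bounded u Hu) as [M HM].
assert (HM' : forall t, (Rabs (phi (expi t)) <= M)%R).
{ intros t; rewrite <- Hb by apply unit_circle_expi.
  apply HM, closed_unit_disc_circle, unit_circle_expi. }
apply cond_eq; intros e He.
assert (He4 : (0 < e / 4)%R) by lra.
(* The modulus is taken from [u], which is uniformly continuous on the closed disc and agrees with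
   [phi] on the circle. *)
destruct (quadratic_modulus_on_circle u (mkposreal _ He4) Hu) as [c [Hc Hmod]]; simpl in Hmod.
assert (Hlim : is_lim_seq (fun n => 1 - (/ 2) ^ n)%R 1%R).
{ replace (Finite 1) with (Finite (1 - 0)%R) by (apply f_equal; ring).
  apply is_lim_seq_minus'; [apply is_lim_seq_const|apply is_lim_seq_geom].
  rewrite Rabs_pos_eq; lra. }
assert (Hrange : forall n, (0 <= 1 - (/ 2) ^ n < 1)%R).
{ intros n; assert (0 < (/ 2) ^ n)%R by (apply pow_lt; lra).
  assert ((/ 2) ^ n <= 1 ^ n)%R by (apply pow_incr; lra).
  rewrite pow1 in *; lra. }
assert (HP : eventually (fun n =>
  Rabs (poisson_integral phi (RtoC (1 - (/ 2) ^ n) * z) - poisson_integral phi z) < e / 4)%R).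
{ pose proof (continuous_poisson_integral phi M z H HM' Hz) as Hcont.
  assert (Hcomp : continuous (fun r : R => poisson_integral phi (RtoC r * z)) 1%R).
  { apply (continuous_comp (fun r : R => RtoC r * z) (poisson_integral phi)).
    - apply continuous_Cmult; [apply continuous_RtoC, continuous_id|apply continuous_const].
    - rewrite Cmult_1_l; exact Hcont. }
  pose proof (filterlim_comp _ _ _ _ _ _ _ _ Hlim Hcomp _
    (locally_ball _ (mkposreal _ He4))) as Hev.
  unfold filtermap in Hev; rewrite Cmult_1_l in Hev; exact Hev. }
assert (HQ : eventually (fun n => 4 * c * (1 - (1 - (/ 2) ^ n) ^ 2) < e / 4)%R).
{ assert (Hq : is_lim_seq (fun n => 4 * c * (1 - (1 - (/ 2) ^ n) ^ 2))%R 0%R).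
  { replace (Finite 0) with (Finite (4 * c * (1 - 1 * 1))%R) by (apply f_equal; ring).
    apply (is_lim_seq_scal_l _ (4 * c)%R (Finite (1 - 1 * 1)%R)).
    apply is_lim_seq_minus'; [apply is_lim_seq_const|].
    apply (is_lim_seq_ext (fun n => (1 - (/ 2) ^ n) * (1 - (/ 2) ^ n))%R); [intros n; ring|].
    apply is_lim_seq_mult'; exact Hlim. }
  pose proof (Hq _ (locally_ball _ (mkposreal _ He4))) as Hev.
  unfold filtermap in Hev; revert Hev; apply filter_imp; intros n Hn.
  apply Rle_lt_trans with (1 := Rle_abs _).
  assert (Hn' : (Rabs (4 * c * (1 - (1 - (/ 2) ^ n) ^ 2) - 0) < e / 4)%R) by exact Hn.
  rewrite Rminus_0_r in Hn'; exact Hn'. }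
destruct HP as [N1 HP], HQ as [N2 HQ].
set (n := (N1 + N2)%nat).
specialize (HP n ltac:(unfold n; lia)); specialize (HQ n ltac:(unfold n; lia)).
specialize (Hrange n); set (r := (1 - (/ 2) ^ n)%R) in *.
assert (Hclose : (Rabs (u z - poisson_integral phi (RtoC r * z)) <= e / 4 + 4 * c * (1 - r ^ 2))%R).
{ apply dilated_poisson_integral_close; try assumption.
  - intros w Hw; apply poisson_integral_near_boundary; try assumption.
    intros t; rewrite <- !Hb by (assumption || apply unit_circle_expi).
    apply Hmod; [apply unit_circle_expi|exact Hw].
  - unfold closed_unit_disc; lra. }
replace (u z - poisson_integral phi z)%R with ((u z - poisson_integral phi (RtoC r * z))
  + (poisson_integral phi (RtoC r * z) - poisson_integral phi z))%R by ring.
apply Rle_lt_trans with (1 := Rabs_triang _ _); lra.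
Qed.

Theorem mainTheorem2 (phi u : C -> R)
    (hphi : continuous_on unit_circle phi)
    (hu : dirichlet_solution phi u) :
  (forall z, unit_disc z ->
     RtoC (u z) =
     angular_mean (fun theta => poisson_kernel z (expi theta) * phi (expi theta))) /\
  (forall z, unit_disc z ->
     RtoC (u z) = a0 phi + h_of phi z + Cconj (h_of phi z)) /\
  infinitely_C_differentiable_on unit_disc (h_of phi) /\
  h_of phi 0 = 0 /\
  Cinfty_on unit_disc u /\
  (forall z, unit_disc z -> laplacian u z = 0%R) /\
  infinitely_C_differentiable_on unit_disc (H_of phi) /\
  (forall z, unit_disc z -> u z = Re (H_of phi z)).
Proof.
pose proof (continuous_on_circle_boundary phi hphi) as H.
assert (Hu : forall z, unit_disc z -> u z = poisson_integral phi z).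
{ intros z Hz; apply dirichlet_solution_poisson_integral; try assumption.
  apply (proj1 (unit_disc_Cmod z)), Hz. }
destruct (continuous_on_closed_disc_bounded u (proj1 hu)) as [M HM].
assert (HM' : forall t, (Rabs (phi (expi t)) <= M)%R).
{ intros t; rewrite <- (proj2 (proj2 hu)) by apply unit_circle_expi.
  apply HM, closed_unit_disc_circle, unit_circle_expi. }
pose proof (derivative_chain_cauchy_integral phi M H HM') as HG.
assert (Hh : forall z, unit_disc z -> h_of phi z = - RtoC (a0 phi) + 1 * cauchy_integral phi 0 z).
{ intros z Hz; rewrite Cmult_1_l.
  apply h_of_cauchy_integral; [exact H|apply (proj1 (unit_disc_Cmod z)), Hz]. }
(* [H] and [h] come from the same chain with the same constant:
   [a0 + 2 (- a0 + G_0) = - a0 + 2 G_0]. *)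
assert (HH : forall z, unit_disc z -> H_of phi z = - RtoC (a0 phi) + 2 * cauchy_integral phi 0 z).
{ intros z Hz; unfold H_of; rewrite Hh by exact Hz; ring. }
pose proof (derivative_chain_affine unit_disc (- RtoC (a0 phi)) 1 _ HG) as Gh.
pose proof (derivative_chain_affine unit_disc (- RtoC (a0 phi)) 2 _ HG) as GH.
assert (HRe : forall z, unit_disc z -> u z = Re (H_of phi z)).
{ intros z Hz; rewrite Hu by exact Hz.
  unfold poisson_integral, H_of; rewrite re_plus, re_scal_l, re_RtoC; reflexivity. }
assert (HRe' : forall z, unit_disc z ->
  u z = Re (1 * affine_chain (- RtoC (a0 phi)) 2 (cauchy_integral phi) 0 z)).
{ intros z Hz; rewrite HRe, HH, Cmult_1_l by exact Hz; reflexivity. }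
repeat apply conj.
- intros z Hz; rewrite Hu by exact Hz; apply (proj1 (unit_disc_Cmod z)) in Hz.
  symmetry; apply is_mean_unique.
  refine (is_mean_ext _ _ _ _ (is_mean_poisson_integral phi z H Hz)); intros t; cbv beta.
  rewrite poisson_kernel_expi, RtoC_mult by exact Hz; reflexivity.
- intros z Hz; rewrite Hu by exact Hz.
  unfold poisson_integral; rewrite RtoC_plus, RtoC_mult, re_alt; field.
- exact (infinitely_C_differentiable_chain _ _ Gh Hh).
- apply is_mean_unique, (is_mean_ext (fun _ => 0)); [|apply is_mean_const].
  intros t; unfold Cdiv; ring.
- intros k; exact (Ck_on_Re_chain _ GH k 0 1 u HRe').
- intros z Hz; exact (laplacian_Re_chain _ 1 z u GH HRe' Hz).
- exact (infinitely_C_differentiable_chain _ _ GH HH).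
- exact HRe.
Qed.
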